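(* Let $D$ be a diagram with $N$ crossings of an oriented knot $K\subset S^3$, let $\mathsf a_i,\mathsf a_j$ be two arcs of $D$, and fix a choice of sign-types $\epsilon=(\epsilon_+,\epsilon_-)$. Then the generalized Riley polynomial $R_{ij}(y)$ has rational coefficients and is square-splitting, i.e. $R_{ij}(u^2)=g_{ij}(u)\,g_{ij}^*(u)$ with $g_{ij}(u)\in\mathbb Q[u]$, where $g_{ij}$ is the $u$-polynomial at the pair $\mathsf a_i,\mathsf a_j$ and $g^*(u):=(-1)^{\deg g}g(-u)$.
   Context: Diagram conventions: $K$ is an oriented knot in $S^3$, $G_K=\pi_1(S^3\setminus K)$, and $D$ is an oriented diagram of $K$ with crossings $c_1,\dots,c_N$ and arcs $\mathsf a_1,\dots,\mathsf a_N$ (an arc is a connected piece of $D$ between two consecutive under-crossings). The Wirtinger generator of $\mathsf a_i$ is $m_i$. At a crossing with incoming under-arc $\mathsf a_i$, outgoing under-arc $\mathsf a_j$, over-arc $\mathsf a_k$, the Wirtinger relation is $m_j=m_k^{-1}m_im_k$ (positive crossing) or $m_j=m_km_im_k^{-1}$ (negative crossing). A parabolic representation is a non-abelian homomorphism $\rho:G_K\to SL_2(\mathbb C)$ with $\mathrm{tr}\,\rho(m)=2$, $\rho(m)\neq I$ for every meridian $m$. $X_{par}$ is the set of conjugacy classes of parabolic representations, viewed as an affine variety (character variety of parabolic representations). Let $X$ be the union of the zero-dimensional components of $X_{par}$, a finite set (if $X_{par}$ is zero-dimensional, $X=X_{par}$). For $b=\binom xy\in\mathbb C^2$ let $\mathcal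 M(b)=\begin{pmatrix}1-xy&x^2\\-y^2&1+xy\end{pmatrix}$; put $a\triangleright b=\mathcal M(b)^{-1}a$, $a\triangleleft b=\mathcal M(b)a$. An arc-coloring of sign-type $\epsilon\in\{\pm1\}^N$ is $(a_1,\dots,a_N)\in(\mathbb C^2)^N$ such that at each crossing $c_n$ (with incoming under-arc $\mathsf a_i$, outgoing under-arc $\mathsf a_j$ and over-arc $\mathsf a_k$) $\epsilon_na_j=a_i\triangleright a_k$ if $c_n$ is positive and $\epsilon_na_j=a_i\triangleleft a_k$ if negative; its associated representation is given by $m_i\mapsto\mathcal M(a_i)$. The obstruction class of a parabolic $\rho$ is $\mathrm{ob}(\rho)=\tfrac12\mathrm{tr}\,\rho(\lambda)\in\{\pm1\}$, $\lambda$ a longitude. Fix two sign-types $\epsilon_+,\epsilon_-\in\{\pm1\}^N$ with product of entries $+1$ and $-1$ respectively. For each parabolic $\rho$ with $\mathrm{ob}(\rho)=\pm1$ there are exactly two arc-colorings of sign-type $\epsilon_\pm$ with associated representation $\rho$, of the form $a$ and $-a$. The $u$-value is $u_{ij}(\rho):=\det(a_i,a_j)$ (independent of the choice of $\pm a$ and of the representative in the conjugacy class). The $y$-value is $y_{ij}(\rho):=2-\mathrm{tr}\,\rho(m_im_j)$. Definitions: $R_{ij}(y):=\prod_{\rho\in X}(y-y_{ij}(\rho))$ and $g_{ij}(u):=\prod_{\rho\in X}(u-u_{ij}(\rho))$. *)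

(* Defs.v *)
From HB Require Import structures.
From mathcomp Require Import all_boot all_order all_fingroup all_algebra.
From mathcomp Require Import generic_quotient complex.
From mathcomp Require Import boolp classical_sets fsbigop reals.

Set Implicit Arguments.
Unset Strict Implicit.
Unset Printing Implicit Defensive.

Import GRing.Theory Num.Theory.
Local Open Scope classical_set_scope.
Local Open Scope ring_scope.
Local Open Scope quotient_scope.

(** * Groups given by a presentation *)

(* A letter [(i, true)] stands for the generator [i], [(i, false)] for its
   inverse. *)
Definition word (I : choiceType) := seq (I * bool).

Definition inv_word (I : choiceType) (w : word I) : word I :=
  rev [seq (l.1, ~~ l.2) | l <- w].

Inductive word_eq (I : choiceType) (rels : set (word I * word I)) :
    word I -> word I -> Prop :=
| WordRefl w : word_eq rels w w
| WordSym v w : word_eq rels v w -> word_eq rels w v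
| WordTrans v w x : word_eq rels v w -> word_eq rels w x -> word_eq rels v x
| WordCat v v' w w' :
    word_eq rels v v' -> word_eq rels w w' -> word_eq rels (v ++ w) (v' ++ w')
| WordCancel i b : word_eq rels [:: (i, b); (i, ~~ b)] [::]
| WordRel r : rels r -> word_eq rels r.1 r.2.

Section PresentedGroup.
Variables (I : choiceType) (rels : set (word I * word I)).

Definition word_eqb (v w : word I) : bool := `[< word_eq rels v w >].

Lemma word_eqb_refl : reflexive word_eqb.
Proof. by move=> w; apply/asboolP; constructor. Qed.

Lemma word_eqb_sym : symmetric word_eqb.
Proof. by move=> v w; apply/asboolP/asboolP; apply: WordSym. Qed.

Lemma word_eqb_trans : transitive word_eqb.
Proof.
move=> w v x /asboolP vw /asboolP wx; apply/asboolP; exact: WordTrans vw wx.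
Qed.

Canonical word_equiv := EquivRel word_eqb
  word_eqb_refl word_eqb_sym word_eqb_trans.

Definition presented := {eq_quot word_equiv}.
HB.instance Definition _ := Choice.on presented.

Definition presented_class (w : word I) : presented := \pi w.

Lemma presented_classK (x : presented) : presented_class (repr x) = x.
Proof. exact: reprK. Qed.

Lemma presentedP (v w : word I) :
  presented_class v = presented_class w <-> word_eq rels v w.
Proof.
by split=> [/eqmodP/asboolP|vw] //; apply/eqmodP/asboolP.
Qed.

Lemma repr_presented (w : word I) : word_eq rels (repr (presented_class w)) w.
Proof. by apply/presentedP; rewrite presented_classK. Qed.

Definition presented_mul (x y : presented) : presented :=
  presented_class (repr x ++ repr y).
Definition presented_one : presented := presented_class [::].
Definition presented_inv (x : presented) : presented :=
  presented_class (inv_word (repr x)).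

Lemma presented_mulE (v w : word I) :
  presented_mul (presented_class v) (presented_class w)
  = presented_class (v ++ w).
Proof. by apply/presentedP; apply: WordCat; exact: repr_presented. Qed.

Lemma inv_word_cons l (w : word I) :
  inv_word (l :: w) = inv_word w ++ [:: (l.1, ~~ l.2)].
Proof. by rewrite /inv_word /= rev_cons cats1. Qed.

Lemma inv_wordK : involutive (@inv_word I).
Proof.
move=> w; rewrite /inv_word map_rev revK -map_comp -[RHS]map_id.
by apply: eq_map => -[i b] /=; rewrite negbK.
Qed.

Lemma word_mulV (w : word I) : word_eq rels (w ++ inv_word w) [::].
Proof.
elim: w => [|[i b] w IHw]; first exact: WordRefl.
rewrite inv_word_cons -cat1s -catA [w ++ _]catA.
apply: WordTrans (WordCancel rels i b).
rewrite -[[:: _; _]]/([:: (i, b)] ++ ([::] ++ [:: (i, ~~ b)])).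
by apply: WordCat; [|apply: WordCat => //]; apply: WordRefl.
Qed.

Lemma presented_mulA : associative presented_mul.
Proof.
move=> x y z; rewrite -[x]presented_classK -[y]presented_classK.
by rewrite -[z]presented_classK !presented_mulE catA.
Qed.

Lemma presented_mul1 : left_id presented_one presented_mul.
Proof. by move=> x; rewrite -[x]presented_classK presented_mulE. Qed.

Lemma presented_mulr1 : right_id presented_one presented_mul.
Proof. by move=> x; rewrite -[x]presented_classK presented_mulE cats0. Qed.

Lemma presented_mulV : right_inverse presented_one presented_inv presented_mul.
Proof.
move=> x; rewrite -{1}[x]presented_classK presented_mulE; apply/presentedP.
exact: word_mulV.
Qed.

Lemma presented_mulVl : left_inverse presented_one presented_inv presented_mul.
Proof.
move=> x; rewrite -{2}[x]presented_classK presented_mulE; apply/presentedP.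
by rewrite -{2}[repr x]inv_wordK; exact: word_mulV.
Qed.

HB.instance Definition _ := isGroup.Build presented
  presented_mulA presented_mul1 presented_mulr1 presented_mulVl presented_mulV.

Definition presented_gen (i : I) : presented := presented_class [:: (i, true)].

End PresentedGroup.

(** * Oriented knot diagrams *)

(* A diagram with crossings ['I_N] is encoded by its signed Gauss code: a pass
   [(c, true)] (resp. [(c, false)]) is the passage of the knot through the
   crossing [c] along its over-strand (resp. under-strand). *)
Definition pass (N : nat) := ('I_N * bool)%type.
Definition over_pass N (c : 'I_N) : pass N := (c, true).
Definition under_pass N (c : 'I_N) : pass N := (c, false).

(* The four half-edges at [c] are [(s, true)], leaving [c], and [(s, false)],
   arriving at [c], for the two passes [s] at [c]. Rotating counterclockwise
   around [c] one meets over-out, under-out, over-in, under-in if [c] is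
   positive, and over-out, under-in, over-in, under-out if it is negative. *)
Definition half_edge (N : nat) := (pass N * bool)%type.

Definition rotate N (pos : 'I_N -> bool) (h : half_edge N) : half_edge N :=
  let: (c, over, out) := h in
  (c, ~~ over, if over then out (+) ~~ pos c else out (+) pos c).

Definition other_end N (next : {perm pass N}) (h : half_edge N) : half_edge N :=
  let: (s, out) := h in
  if out then (next s, false) else ((next^-1)%g s, true).

(* The orbits of this permutation of the half-edges are the faces of the
   oriented surface on which the Gauss code is naturally drawn. *)
Definition face_step N (next : {perm pass N}) (pos : 'I_N -> bool) :
    half_edge N -> half_edge N :=
  rotate pos \o other_end next.

(* [next] sends a pass to the one that follows it along the knot. [diag_arc s]
   is the arc that the knot runs along when it leaves the pass [s]; arcs are
   numbered by ['I_N] in an arbitrary way. The 4-valent graph of the diagram is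
   connected, with [N] vertices and [2N] edges, so by Euler's formula it is
   drawn on the sphere if and only if it has [N + 2] faces. *)
Record knot_diagram (N : nat) := KnotDiagram {
  next : {perm pass N};
  positive : 'I_N -> bool;
  diag_arc : pass N -> 'I_N;
  next_cyclic : forall s t, t \in porbit next s;
  diag_arc_over : forall s,
    (next s).2 -> diag_arc (next s) = diag_arc s;
  diag_arc_under : injective (fun c => diag_arc (under_pass c));
  planar : fcard (face_step next positive) predT = N.+2
}.

Section KnotGroup.
Variables (N : nat) (D : knot_diagram N).

Definition arc_in (c : 'I_N) : 'I_N :=
  diag_arc D ((next D)^-1%g (under_pass c)).
Definition arc_out (c : 'I_N) : 'I_N := diag_arc D (under_pass c).
Definition arc_over (c : 'I_N) : 'I_N := diag_arc D (over_pass c).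

Definition wirtinger_rel (c : 'I_N) : word 'I_N * word 'I_N :=
  let i := arc_in c in let j := arc_out c in let k := arc_over c in
  ([:: (j, true)],
   if positive D c then [:: (k, false); (i, true); (k, true)]
   else [:: (k, true); (i, true); (k, false)]).

(* The fundamental group of the complement of the knot, through its Wirtinger
   presentation. *)
Definition knot_group := presented (range wirtinger_rel).
HB.instance Definition _ := Group.on knot_group.

Definition wirtinger (i : 'I_N) : knot_group := presented_gen _ i.

Definition meridian : set knot_group :=
  [set m | exists i g, m = (wirtinger i ^ g)%g].

(* Follow the knot once around, from the arc leaving the under-pass of [c] back
   to that under-pass, recording each over-arc with the sign of the crossing;
   the last factor makes the result null-homologous. *)
Definition longitude_at (c : 'I_N) : knot_group :=
  ((\prod_(s <- traject (next D) (next D (under_pass c)) N.*2 | ~~ s.2)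
      (if positive D s.1 then wirtinger (arc_over s.1)
       else (wirtinger (arc_over s.1))^-1))
   * \prod_(n < N)
      (if positive D n then (wirtinger (arc_out c))^-1
       else wirtinger (arc_out c)))%g.

Definition longitude : set knot_group :=
  [set l | exists c g, l = (longitude_at c ^ g)%g].

End KnotGroup.

(** * The group SL_2(C) *)

Section SL2.
Variable R : realType.

Definition SL2 := {A : 'M[R[i]]_2 | \det A == 1}.
HB.instance Definition _ := Choice.on SL2.

Lemma SL2_det (A : SL2) : \det (val A) = 1. Proof. exact/eqP/(valP A). Qed.

Lemma SL2_unit (A : SL2) : val A \in unitmx.
Proof. by rewrite unitmxE SL2_det unitr1. Qed.

Lemma SL2_one_subproof : \det (1%:M : 'M[R[i]]_2) == 1.
Proof. by rewrite det1. Qed.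
Definition SL2_one : SL2 := Sub 1%:M SL2_one_subproof.

Lemma SL2_mul_subproof (A B : SL2) : \det (val A *m val B) == 1.
Proof. by rewrite det_mulmx !SL2_det mulr1. Qed.
Definition SL2_mul (A B : SL2) : SL2 :=
  Sub (val A *m val B) (SL2_mul_subproof A B).

Lemma SL2_inv_subproof (A : SL2) : \det (invmx (val A)) == 1.
Proof. by rewrite det_inv SL2_det invr1. Qed.
Definition SL2_inv (A : SL2) : SL2 :=
  Sub (invmx (val A)) (SL2_inv_subproof A).

Lemma SL2_mulA : associative SL2_mul.
Proof. by move=> A B C; apply: val_inj; rewrite /= mulmxA. Qed.

Lemma SL2_mul1 : left_id SL2_one SL2_mul.
Proof. by move=> A; apply: val_inj; rewrite /= mul1mx. Qed.

Lemma SL2_mulr1 : right_id SL2_one SL2_mul.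
Proof. by move=> A; apply: val_inj; rewrite /= mulmx1. Qed.

Lemma SL2_mulVl : left_inverse SL2_one SL2_inv SL2_mul.
Proof. by move=> A; apply: val_inj; rewrite /= mulVmx // SL2_unit. Qed.

Lemma SL2_mulV : right_inverse SL2_one SL2_inv SL2_mul.
Proof. by move=> A; apply: val_inj; rewrite /= mulmxV // SL2_unit. Qed.

HB.instance Definition _ := isGroup.Build SL2
  SL2_mulA SL2_mul1 SL2_mulr1 SL2_mulVl SL2_mulV.

End SL2.

(** * Parabolic representations and their character variety *)

Section ParabolicRepresentations.
Variables (R : realType) (N : nat) (D : knot_diagram N).
Local Notation G := (knot_group D).
Local Notation C := R[i].

Definition is_parabolic (rho : {multiplicative G -> SL2 R}) : Prop :=
  (exists g h, (rho g * rho h)%g <> (rho h * rho g)%g) /\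
  (forall m, meridian m -> \tr (val (rho m)) = 2 /\ rho m <> 1%g).

Record parabolic := Parabolic {
  parabolic_rep :> {multiplicative G -> SL2 R};
  parabolic_repP : is_parabolic parabolic_rep
}.
HB.instance Definition _ := gen_eqMixin parabolic.
HB.instance Definition _ := gen_choiceMixin parabolic.

Definition conjugate_rep (rho rho' : parabolic) : bool :=
  `[< exists P : SL2 R, forall g, rho' g = (rho g ^ P)%g >].

Lemma conjugate_rep_refl : reflexive conjugate_rep.
Proof. by move=> rho; apply/asboolP; exists 1%g => g; rewrite conjg1. Qed.

Lemma conjugate_rep_sym : symmetric conjugate_rep.
Proof.
by move=> rho rho'; apply/asboolP/asboolP => -[P PE];
  exists (P^-1)%g => g; rewrite PE conjgK.
Qed.

Lemma conjugate_rep_trans : transitive conjugate_rep.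
Proof.
move=> rho2 rho1 rho3 /asboolP[P PE] /asboolP[Q QE]; apply/asboolP.
by exists (P * Q)%g => g; rewrite QE PE conjgM.
Qed.

Canonical conjugate_rep_equiv := EquivRel conjugate_rep
  conjugate_rep_refl conjugate_rep_sym conjugate_rep_trans.

Definition Xpar := {eq_quot conjugate_rep_equiv}.

(* The coordinate ring of the character variety is generated by the trace
   functions of the elements of the group. *)
Inductive regular_fun : set (Xpar -> C) :=
| RegularCst c : regular_fun (fun=> c)
| RegularTr g : regular_fun (fun x => \tr (val (repr x g)))
| RegularAdd f h :
    regular_fun f -> regular_fun h -> regular_fun (fun x => f x + h x)
| RegularMul f h :
    regular_fun f -> regular_fun h -> regular_fun (fun x => f x * h x).

Definition zariski_closed (Z : set Xpar) : Prop :=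
  exists F, F `<=` regular_fun /\ Z = [set x | forall f, F f -> f x = 0].

Definition irreducible_closed (Z : set Xpar) : Prop :=
  [/\ zariski_closed Z, Z !=set0 &
      forall A B, zariski_closed A -> zariski_closed B ->
        Z `<=` A `|` B -> Z `<=` A \/ Z `<=` B].

Definition irreducible_component (Z : set Xpar) : Prop :=
  irreducible_closed Z /\
  forall W, irreducible_closed W -> Z `<=` W -> W = Z.

(* For an irreducible closed set, Krull dimension zero: it is not the top of a
   chain of irreducible closed sets of length one. *)
Definition zero_dimensional (Z : set Xpar) : Prop :=
  forall W, irreducible_closed W -> W `<=` Z -> W = Z.

Definition Xzero : set Xpar :=
  [set x | exists Z, [/\ irreducible_component Z, zero_dimensional Z & Z x]].

(** * Arc-colorings *)

Definition coloring_mx (b : 'cV[C]_2) : 'M[C]_2 :=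
  let x := b 0 0 in let y := b 1 0 in
  \matrix_(r, s)
    if r == 0 then (if s == 0 then 1 - x * y else x ^+ 2)
    else (if s == 0 then - y ^+ 2 else 1 + x * y).

Definition tri_right (a b : 'cV[C]_2) : 'cV[C]_2 := invmx (coloring_mx b) *m a.
Definition tri_left (a b : 'cV[C]_2) : 'cV[C]_2 := coloring_mx b *m a.

(* A sign-type is encoded by booleans, [eps n] standing for the sign
   [(-1) ^+ eps n]. *)
Definition arc_coloring (eps : 'I_N -> bool) (a : 'I_N -> 'cV[C]_2) : Prop :=
  forall n, (-1) ^+ eps n *: a (arc_out D n) =
    if positive D n then tri_right (a (arc_in D n)) (a (arc_over D n))
    else tri_left (a (arc_in D n)) (a (arc_over D n)).

Definition associated_rep (a : 'I_N -> 'cV[C]_2) (rho : parabolic) : Prop :=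
  forall i, val (rho (wirtinger D i)) = coloring_mx (a i).

Definition obstruction (lambda : G) (rho : parabolic) : C :=
  2^-1 * \tr (val (rho lambda)).

(* The coloring with associated representation [rho], of sign-type [epsp] or
   [epsm] according to the obstruction class of [rho]; it is unique up to
   sign. *)
Definition coloring_of (lambda : G) (epsp epsm : 'I_N -> bool)
    (rho : parabolic) : 'I_N -> 'cV[C]_2 :=
  let eps := if obstruction lambda rho == 1 then epsp else epsm in
  xget (fun=> 0) [set a | arc_coloring eps a /\ associated_rep a rho].

Definition u_value (lambda : G) (epsp epsm : 'I_N -> bool) (i j : 'I_N)
    (rho : parabolic) : C :=
  let a := coloring_of lambda epsp epsm rho in
  \det (row_mx (a i) (a j) : 'M[C]_2).

Definition y_value (i j : 'I_N) (rho : parabolic) : C :=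
  2 - \tr (val (rho (wirtinger D i * wirtinger D j)%g)).

(* The values above are constant on conjugacy classes, and [repr x] is a
   representative of the class [x]. [Xzero] is finite, being a set of isolated
   points of an affine variety, so that the iterated products below are genuine
   (over an infinite set they would be [1] by convention). *)
Definition riley_poly (i j : 'I_N) : {poly C} :=
  \big[*%R/1]_(x \in Xzero) ('X - (y_value i j (repr x))%:P).

Definition u_poly (lambda : G) (epsp epsm : 'I_N -> bool) (i j : 'I_N) :
    {poly C} :=
  \big[*%R/1]_(x \in Xzero)
    ('X - (u_value lambda epsp epsm i j (repr x))%:P).

End ParabolicRepresentations.

Definition star_poly (F : nzRingType) (g : {poly F}) : {poly F} :=
  (-1) ^+ (size g).-1 *: (g \Po (- 'X)).

Definition rational_poly (R : realType) (p : {poly R[i]}) : Prop :=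
  exists q : {poly rat}, p = map_poly ratr q.

(* Main.v *)
Require Import Defs.
From HB Require Import structures.
From mathcomp Require Import all_boot all_order all_fingroup all_algebra.
From mathcomp Require Import generic_quotient complex ring.
From mathcomp Require Import boolp classical_sets functions cardinality fsbigop.
From mathcomp Require Import reals.

(* A representation in [X] and its coloring are determined by equations over the
   rationals, so an automorphism of the complex numbers permutes [X] (it acts on
   [X_par] by Zariski homeomorphisms) and sends the u-value of [rho] to that of
   the conjugate representation. Hence both polynomials are fixed by all field
   automorphisms, and a complex number [z] with that property is rational:
   otherwise the complex numbers are algebraic over any subfield [L] that is
   maximal among those avoiding [z], and [z] can be moved to another root of its
   minimal polynomial over [L]. The factorization follows from
   [tr (M(a) M(b)) = 2 - det(a, b)^2] once the coloring is known to exist: push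
   an eigenvector along the knot, and the signs picked up after one turn are the
   product of the sign-type times the eigenvalue of the longitude, so that the
   coloring closes up exactly when that product is [ob(rho)]. *)

Set Implicit Arguments.
Unset Strict Implicit.
Unset Printing Implicit Defensive.

Import GRing.Theory Num.Theory.
Local Open Scope classical_set_scope.
Local Open Scope ring_scope.
Local Open Scope quotient_scope.

(** * Automorphisms of an algebraically closed field *)

(* The graph of an isomorphism between two subfields of [F]. *)
Record subfield_iso (F : fieldType) (S : set (F * F)) : Prop := SubfieldIso {
  subfield_iso1 : S 1;
  subfield_isoB : forall u v, S u -> S v -> S (u - v);
  subfield_isoM : forall u v, S u -> S v -> S (u * v);
  subfield_isoV : forall u, S u -> S (u.1^-1, u.2^-1);
  subfield_iso_eq0 : forall u, S u -> (u.1 == 0) = (u.2 == 0)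
}.

Section SubfieldIsoField.
Variables (F : fieldType) (S : set (F * F)) (Siso : subfield_iso S).

(** The phantom argument lets the closure instance, and with it the field structure, be recovered
    from the predicate. *)
Definition iso_pred of subfield_iso S : {pred F * F} := [pred u | u \in S].

Lemma iso_pred_divring_closed : divring_closed (iso_pred Siso).
Proof.
have [S1 SB SM SV S0] := Siso.
split=> [|u v|u v]; rewrite !inE; [exact: S1 | exact: SB |].
move=> Su Sv; apply: SM => //; rewrite /GRing.inv /= /pair_invr.
(* The inverse of a non-unit pair in the product ring is the pair itself, which is already in
   [S]. *)
case: ifP => // /andP[v1 v2].
exact: (SV v).
Qed.

HB.instance Definition _ :=
  GRing.isDivringClosed.Build (F * F)%type (iso_pred Siso)
    iso_pred_divring_closed.

(** The graph serves as an abstract field with two embeddings in [F], its projections. A polynomial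
    over it thus has two images over [F], exchanged by the isomorphism. *)
Record iso_field := IsoField {
  iso_field_val :> F * F;
  _ : iso_field_val \in iso_pred Siso
}.
HB.instance Definition _ := [isSub for iso_field_val].
HB.instance Definition _ := [Choice of iso_field by <:].
HB.instance Definition _ := [SubChoice_isSubComUnitRing of iso_field by <:].

Lemma iso_field_axiom : GRing.field_axiom iso_field.
Proof.
move=> [u Su] u_neq0; apply/unitrPr.
have Su' : S u by have := Su; rewrite inE.
have Vu : (u.1^-1, u.2^-1) \in iso_pred Siso.
  by rewrite inE; apply: subfield_isoV Siso _ Su'.
exists (IsoField Vu); apply: val_inj.
have u1 : u.1 != 0.
  apply: contraNneq u_neq0 => u1; apply/eqP/val_inj => /=.
  have /eqP u2 : u.2 == 0 by rewrite -(subfield_iso_eq0 Siso Su') u1.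
  by rewrite [u]surjective_pairing u1 u2.
have u2 : u.2 != 0 by rewrite -(subfield_iso_eq0 Siso Su').
by congr (_, _); rewrite /= divff.
Qed.
HB.instance Definition _ := GRing.ComUnitRing_isField.Build iso_field
  iso_field_axiom.

Definition iso_dom : iso_field -> F := fst \o val.
Definition iso_cod : iso_field -> F := snd \o val.
HB.instance Definition _ := GRing.RMorphism.on iso_dom.
HB.instance Definition _ := GRing.RMorphism.on iso_cod.

Lemma iso_fieldP u : S u -> exists k : iso_field, val k = u.
Proof.
move=> Su; have Pu : u \in iso_pred Siso by rewrite inE.
by exists (IsoField Pu).
Qed.

Lemma iso_field_mem (k : iso_field) : S (iso_dom k, iso_cod k).
Proof.
rewrite /iso_dom /iso_cod /= -surjective_pairing.
by case: k => u Su; have := Su; rewrite inE => uS; apply: uS.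
Qed.

End SubfieldIsoField.

(** * Minimal polynomials *)

Section Irreducible.
Variables (K F : fieldType) (f : {rmorphism K -> F}).
Implicit Types p q : {poly K}.

(** If [q] vanishes at [x], so does its gcd with [p]; the gcd is then not constant, hence associated
    to [p]. *)
Lemma irreducible_dvdp_root p q x : irreducible_poly p ->
  root (map_poly f p) x -> (p %| q) = root (map_poly f q) x.
Proof.
move=> [p_gt1 p_irr] px; apply/idP/idP => [/dvdpP[r ->]|qx].
  by rewrite rmorphM rootM px orbT.
have gcdx : root (map_poly f (gcdp p q)) x by rewrite gcdp_map root_gcd px.
have sz_gcd : size (gcdp p q) != 1.
  apply: contraTneq gcdx => /eqP/size_poly1P[c c0 ->].
  by rewrite map_polyC rootC fmorph_eq0.
have /andP[_ p_gcd] := p_irr _ sz_gcd (dvdp_gcdl p q).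
by apply: dvdp_trans p_gcd (dvdp_gcdr p q).
Qed.

(** Among the nonzero polynomials vanishing at [x], one of least size is irreducible: in a
    factorization one factor vanishes at [x], and it cannot be smaller. *)
Lemma algebraic_irreducible x : algebraicOver f x ->
  exists2 p, irreducible_poly p & root (map_poly f p) x.
Proof.
move=> [p0 p0_neq0 p0x].
pose P n := `[< exists p, [/\ p != 0, root (map_poly f p) x & size p = n] >].
have exP : exists n, P n by exists (size p0); apply/asboolP; exists p0.
case: (ex_minnP exP) => n /asboolP[p [p_neq0 px <-]] min_p.
have {}min_p q : q != 0 -> root (map_poly f q) x -> (size p <= size q)%N.
  by move=> q0 qx; apply: min_p; apply/asboolP; exists q.
exists p => //; split=> [|q q_neq1 /dvdpP[r p_rq]].
  rewrite -(size_map_poly f p); apply: root_size_gt1 px.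
  by rewrite map_poly_eq0.
have /norP[r0 q0] : ~~ ((r == 0) || (q == 0)) by rewrite -mulf_eq0 -p_rq.
have q_p : q %| p by rewrite p_rq dvdp_mulIr.
have le_qp : (size q <= size p)%N by apply: dvdp_leq.
rewrite -dvdp_size_eqp // eqn_leq le_qp /=.
have /orP[rx|] : root (map_poly f r) x || root (map_poly f q) x.
- by rewrite -rootM -rmorphM -p_rq.
- have := min_p r r0 rx; rewrite p_rq size_mul // => le_rq.
  by case: (size q) (size_poly_eq0 q) q_neq1 le_rq => [|[|m]] //=;
     [rewrite (negPf q0) | rewrite !addnS /= addnC ltnNge leq_addl].
- exact: min_p.
Qed.

End Irreducible.
Section Extension.
Variables (F : fieldType) (S : set (F * F)) (Siso : subfield_iso S).

(** Evaluation at [x] and at [y] both have kernel generated by [p], so the pairs of values form the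
    graph of an isomorphism between two copies of the quotient by [p]. *)
Lemma subfield_iso_extend (p : {poly iso_field Siso}) x y :
    irreducible_poly p -> root (map_poly (@iso_dom _ _ Siso) p) x ->
    root (map_poly (@iso_cod _ _ Siso) p) y ->
  exists T, [/\ subfield_iso T, S `<=` T & T (x, y)].
Proof.
move=> p_irr px py.
pose ev q := ((map_poly (@iso_dom _ _ Siso) q).[x],
              (map_poly (@iso_cod _ _ Siso) q).[y]).
have evE0 q : ((ev q).1 == 0) = ((ev q).2 == 0).
  have := irreducible_dvdp_root q p_irr py.
  by rewrite (irreducible_dvdp_root q p_irr px).
exists (range ev); split.
- split=> [|u v|u v|u|u].
  + by exists 1 => //; rewrite /ev !rmorph1 !hornerC.
  + by move=> [q _ <-] [r _ <-]; exists (q - r) => //;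
      rewrite /ev !rmorphB !hornerD !hornerN.
  + by move=> [q _ <-] [r _ <-]; exists (q * r) => //;
      rewrite /ev !rmorphM !hornerM.
  (* A pair that vanishes in one coordinate vanishes in both and is its own inverse. Otherwise [q]
     is prime to [p], and the Bezout coefficient [b], divided by the constant [c], evaluates to the
     inverse of [q]. *)
  + move=> [q _ <-]; have [q0|q0] := boolP ((ev q).1 == 0).
      exists 0 => //; move: (q0); rewrite {1}evE0 => /eqP ->.
      by rewrite (eqP q0) !invr0 /ev !rmorph0 !horner0.
    have cpq : coprimep p q.
      rewrite irreducible_poly_coprime // (irreducible_dvdp_root q p_irr px).
      exact: q0.
    have [[a b] /=] := Bezout_coprimepP _ _ cpq.
    rewrite -size_poly_eq1 => /size_poly1P[c c0 abc].
    have evc : ((ev b).1 * (ev q).1 = iso_dom c)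
             * ((ev b).2 * (ev q).2 = iso_cod c).
      rewrite -[iso_dom c](hornerC _ x) -[iso_cod c](hornerC _ y).
      rewrite -!map_polyC -abc ![map_poly _ (_ + _)]rmorphD !rmorphM /=.
      by rewrite !hornerD !hornerM (rootP px) (rootP py) !mulr0 !add0r.
    exists (c^-1 *: b) => //.
    have [q1 q2] : (ev q).1 != 0 /\ (ev q).2 != 0 by rewrite -evE0.
    have [evc1 evc2] := evc; rewrite /ev !map_polyZ !hornerZ /=.
    have b1 : (ev b).1 != 0.
      apply: contraNneq c0 => b1; move/eqP: evc1.
      by rewrite b1 mul0r eq_sym fmorph_eq0.
    have b2 : (ev b).2 != 0 by rewrite -evE0.
    have -> : iso_dom c^-1 = (iso_dom c)^-1 by apply: fmorphV.
    have -> : iso_cod c^-1 = (iso_cod c)^-1 by apply: fmorphV.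
    rewrite -evc1 -evc2; congr (_, _).
      by rewrite invfM mulrC mulrA mulfV ?mul1r.
    by rewrite invfM mulrC mulrA mulfV ?mul1r.
  + by move=> [q _ <-] /=; apply: evE0.
- move=> u /(iso_fieldP Siso)[k <-]; exists k%:P => //.
  by rewrite /ev !map_polyC !hornerC /iso_dom /iso_cod /= -surjective_pairing.
- by exists 'X => //; rewrite /ev !map_polyX !hornerX.
Qed.

End Extension.

Section Inclusion.
Variables (F : fieldType) (S T : set (F * F)).
Variables (Siso : subfield_iso S) (Tiso : subfield_iso T) (ST : S `<=` T).

Lemma iso_incl_subproof (k : iso_field Siso) : val k \in iso_pred Tiso.
Proof. by rewrite inE; apply: ST; case: k => u Su; have := Su; rewrite inE. Qed.

Definition iso_incl (k : iso_field Siso) : iso_field Tiso :=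
  IsoField (iso_incl_subproof k).

Lemma iso_incl0 : iso_incl 0 = 0. Proof. exact: val_inj. Qed.

Lemma algebraic_dom_incl x :
  algebraicOver (@iso_dom _ _ Siso) x -> algebraicOver (@iso_dom _ _ Tiso) x.
Proof.
move=> [p p0 px]; exists (map_poly iso_incl p).
  apply: contraNneq p0 => /polyP p'0; apply/eqP/polyP => n.
  have /(congr1 val) := p'0 n; rewrite coef_map_id0 ?iso_incl0 // !coef0 => pn.
  exact: val_inj.
rewrite (_ : map_poly _ _ = map_poly (@iso_dom _ _ Siso) p) //.
by apply/polyP => n; rewrite !coef_map /= coef_map_id0 ?iso_incl0.
Qed.

Lemma algebraic_cod_incl x :
  algebraicOver (@iso_cod _ _ Siso) x -> algebraicOver (@iso_cod _ _ Tiso) x.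
Proof.
move=> [p p0 px]; exists (map_poly iso_incl p).
  apply: contraNneq p0 => /polyP p'0; apply/eqP/polyP => n.
  have /(congr1 val) := p'0 n; rewrite coef_map_id0 ?iso_incl0 // !coef0 => pn.
  exact: val_inj.
rewrite (_ : map_poly _ _ = map_poly (@iso_cod _ _ Siso) p) //.
by apply/polyP => n; rewrite !coef_map /= coef_map_id0 ?iso_incl0.
Qed.

End Inclusion.

(** The forbidden set [B] allows two uses: an empty [B] gives an isomorphism with no proper
    extension, and a suitable [B] a subfield maximal among those avoiding an element. *)
Lemma subfield_iso_Zorn (F : fieldType) (S B : set (F * F)) :
    subfield_iso S -> S `&` B = set0 ->
  exists T, [/\ subfield_iso T, S `<=` T, T `&` B = set0 &
    forall U, subfield_iso U -> T `<=` U -> U `&` B = set0 -> U = T].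
Proof.
move=> Siso SB.
(* [A `|` S] rather than [A], for the sake of the empty chain. *)
pose P A := subfield_iso (A `|` S) /\ (A `|` S) `&` B = set0.
suff Pchain (C : set (set (F * F))) : C `<=` P -> total_on C subset ->
    P (\bigcup_(X in C) X).
  have [A [[Aiso AB] Amax]] := Zorn_bigcup Pchain.
  exists (A `|` S); split=> // U Uiso AU UB.
  have [eAU|neq] := pselect (A = U).
    by apply/seteqP; split=> // u; rewrite -eAU; left.
  have SU : U `|` S = U by apply/setUidPl => u Su; apply: AU; right.
  case: (Amax U); last by rewrite /P SU.
  by rewrite properEneq; split; [apply/eqP | move=> u Au; apply: AU; left].
move=> CP Ctot; pose U := (\bigcup_(X in C) X) `|` S.
have CU X : C X -> X `|` S `<=` U.
  by move=> CX u [Xu|Su]; [left; exists X | right].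
have U1 u : U u -> exists X, [/\ subfield_iso X, X `<=` U & X u].
  case=> [[X CX Xu]|Su]; last by exists S; split=> // v Sv; right.
  by exists (X `|` S); split; [case: (CP X CX) | exact: CU | left].
(* Two elements of the union lie in a common member of the chain, so that closure under the
   operations is checked there. *)
have U2 u v : U u -> U v ->
    exists X, [/\ subfield_iso X, X `<=` U, X u & X v].
  case=> [[X CX Xu]|Su]; case=> [[Y CY Yv]|Sv].
  - have [XY|YX] := Ctot X Y CX CY.
      by exists (Y `|` S); split;
        [case: (CP Y CY) | exact: CU | left; apply: XY | left].
    by exists (X `|` S); split;
      [case: (CP X CX) | exact: CU | left | left; apply: YX].
  - by exists (X `|` S); split; [case: (CP X CX) | exact: CU | left | right].
  - by exists (Y `|` S); split; [case: (CP Y CY) | exact: CU | right | left].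
  - by exists S; split=> // w Sw; right.
split.
  split=> [|u v Uu Uv|u v Uu Uv|u Uu|u Uu].
  - by right; apply: subfield_iso1.
  - by have [X [Xi XU Xu Xv]] := U2 u v Uu Uv; apply: XU; apply: subfield_isoB.
  - by have [X [Xi XU Xu Xv]] := U2 u v Uu Uv; apply: XU; apply: subfield_isoM.
  - by have [X [Xi XU Xu]] := U1 u Uu; apply: XU; apply: subfield_isoV.
  - by have [X [Xi XU Xu]] := U1 u Uu; apply: (subfield_iso_eq0 Xi).
apply/seteqP; split=> // u [[[X CX Xu]|Su] Bu]; last by rewrite -SB.
by have [_ <-] := CP X CX; split=> //; left.
Qed.

Lemma closed_root (F : closedFieldType) (p : {poly F}) :
  (1 < size p)%N -> exists x, root p x.
Proof. by move=> p_gt1; apply: closed_rootP; rewrite neq_ltn p_gt1 orbT. Qed.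

(** Take an extension [T] of [S] that is maximal. Any [x] is a root of an irreducible polynomial
    over the domain, whose image on the other side has a root [y]; by maximality [(x, y)] is in [T]
    already. The same argument from the codomain gives surjectivity. *)
Lemma subfield_iso_total (F : closedFieldType) (S : set (F * F))
    (Siso : subfield_iso S) :
    (forall x, algebraicOver (@iso_dom _ _ Siso) x) ->
    (forall y, algebraicOver (@iso_cod _ _ Siso) y) ->
  exists s t : {rmorphism F -> F},
    [/\ cancel s t, cancel t s & forall u, S u -> s u.1 = u.2].
Proof.
move=> dom_alg cod_alg.
have [T [Tiso ST _ Tmax]] := subfield_iso_Zorn Siso (setI0 S).
have {}Tmax U : subfield_iso U -> T `<=` U -> U = T.
  by move=> Ui TU; apply: Tmax => //; apply: setI0.
have dom x : exists y, T (x, y).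
  have [p p_irr px] :=
    algebraic_irreducible (algebraic_dom_incl Tiso ST (dom_alg x)).
  have [|y py] := @closed_root F (map_poly (@iso_cod _ _ Tiso) p).
    by rewrite size_map_poly; case: p_irr.
  have [U [Uiso TU Uxy]] := subfield_iso_extend p_irr px py.
  by exists y; rewrite -(Tmax U).
have cod y : exists x, T (x, y).
  have [p p_irr py] :=
    algebraic_irreducible (algebraic_cod_incl Tiso ST (cod_alg y)).
  have [|x px] := @closed_root F (map_poly (@iso_dom _ _ Tiso) p).
    by rewrite size_map_poly; case: p_irr.
  have [U [Uiso TU Uxy]] := subfield_iso_extend p_irr px py.
  by exists x; rewrite -(Tmax U).
have [s sT] := choice dom; have [t tT] := choice cod.
have inj u v : T u -> T v -> (u.1 == v.1) = (u.2 == v.2).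
  move=> Tu Tv; rewrite -subr_eq0 -[RHS]subr_eq0.
  exact: (subfield_iso_eq0 Tiso (subfield_isoB Tiso Tu Tv)).
have sE u : T u -> s u.1 = u.2.
  by move=> Tu; apply/eqP; rewrite -(inj _ _ (sT u.1) Tu).
have tE u : T u -> t u.2 = u.1.
  by move=> Tu; apply/eqP; rewrite (inj _ _ (tT u.2) Tu).
have sB : zmod_morphism s.
  by move=> x y; apply: (sE (_, _) (subfield_isoB Tiso (sT x) (sT y))).
have sM : monoid_morphism s.
  split; first exact: (sE _ (subfield_iso1 Tiso)).
  by move=> x y; apply: (sE (_, _) (subfield_isoM Tiso (sT x) (sT y))).
have tB : zmod_morphism t.
  by move=> x y; apply: (tE (_, _) (subfield_isoB Tiso (tT x) (tT y))).
have tM : monoid_morphism t.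
  split; first exact: (tE _ (subfield_iso1 Tiso)).
  by move=> x y; apply: (tE (_, _) (subfield_isoM Tiso (tT x) (tT y))).
pose sa := GRing.isZmodMorphism.Build F F s sB.
pose sm := GRing.isMonoidMorphism.Build F F s sM.
pose ta := GRing.isZmodMorphism.Build F F t tB.
pose tm := GRing.isMonoidMorphism.Build F F t tM.
pose sF : {rmorphism F -> F} := HB.pack s sa sm.
pose tF : {rmorphism F -> F} := HB.pack t ta tm.
exists sF, tF; split=> [x|y|u Su] /=.
- exact: (tE _ (sT x)).
- exact: (sE _ (tT y)).
- exact/sE/ST.
Qed.

(** * Numbers fixed by all automorphisms *)

Lemma ratr_subfield_iso (F : numFieldType) :
  subfield_iso (range (fun q : rat => (ratr q : F, ratr q : F))).
Proof.
split.
- by exists 1 => //; rewrite rmorph1.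
- by move=> _ _ [q _ <-] [r _ <-]; exists (q - r) => //; rewrite rmorphB.
- by move=> _ _ [q _ <-] [r _ <-]; exists (q * r) => //; rewrite rmorphM.
- by move=> _ [q _ <-]; exists q^-1 => //; rewrite fmorphV.
- by move=> _ [q _ <-].
Qed.

(** One side has only even powers and the other only odd ones; the coefficient of degree [2n + 1] on
    the right is [q_n]. *)
Lemma comp_poly_sqr_eq0 (K : comNzRingType) (p q : {poly K}) :
  p \Po 'X^2 = 'X * (q \Po 'X^2) -> q = 0.
Proof.
move=> pq; apply/polyP => n; move/polyP/(_ n.*2.+1): pq.
rewrite coefXM !coef_comp_poly_Xn // !dvdn2 /= odd_double /= coef0.
by rewrite -muln2 mulnK.
Qed.

Section SimpleExtension.
Variables (F : fieldType) (S : set (F * F)) (Siso : subfield_iso S).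
Local Notation dom := (@iso_dom _ _ Siso).
Local Notation ev p t := (map_poly dom p).[t].

(** For a diagonal [S], the graph of the identity of L(t). Fractions are used since [t] may be
    transcendental over L. *)
Definition simple_ext (t : F) : set (F * F) :=
  [set u | u.1 = u.2 /\
     exists p q : {poly iso_field Siso}, ev q t != 0 /\ u.1 = ev p t / ev q t].

Lemma simple_ext_iso t : subfield_iso (simple_ext t).
Proof.
split.
- by split=> //; exists 1, 1; rewrite !rmorph1 hornerC divr1 oner_eq0.
- move=> u v [uu [p [q [q0 uE]]]] [vv [p' [q' [q'0 vE]]]]; split=> /=.
    by rewrite uu vv.
  exists (p * q' - p' * q), (q * q').
  rewrite rmorphB !rmorphM /= hornerD hornerN !hornerM mulf_neq0 //.
  by rewrite uE vE; split=> //; rewrite -mulNr addf_div // mulNr.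
- move=> u v [uu [p [q [q0 uE]]]] [vv [p' [q' [q'0 vE]]]]; split=> /=.
    by rewrite uu vv.
  exists (p * p'), (q * q').
  by rewrite !rmorphM /= !hornerM mulf_neq0 // uE vE mulf_div.
- move=> u [uu [p [q [q0 uE]]]]; split=> /=; first by rewrite uu.
  have [p0|p0] := eqVneq (ev p t) 0.
    by exists p, q; rewrite uE p0 mul0r invr0.
  by exists q, p; rewrite uE invf_div.
- by move=> u [->].
Qed.

Lemma simple_ext_gen t : simple_ext t (t, t).
Proof.
split=> //; exists 'X, 1.
by rewrite map_polyX (rmorph1 (map_poly dom)) hornerX hornerC divr1 oner_eq0.
Qed.

Hypothesis Sdiag : forall u, S u -> u.1 = u.2.

Lemma simple_ext_sub t : S `<=` simple_ext t.
Proof.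
move=> u Su; have uu := Sdiag Su; split=> //.
have [k ku] := iso_fieldP Siso Su; exists k%:P, 1%:P.
by rewrite !map_polyC !hornerC /= rmorph1 divr1 oner_eq0 -ku.
Qed.

Lemma iso_dom_cod : @iso_dom _ _ Siso =1 @iso_cod _ _ Siso.
Proof. by move=> k; apply: (Sdiag (iso_field_mem k)). Qed.

End SimpleExtension.

Lemma rat_of_fixed (F : numClosedFieldType) (z : F) :
    (forall s t : {rmorphism F -> F}, cancel s t -> cancel t s -> s z = z) ->
  exists q, z = ratr q.
Proof.
move=> fix_z; apply: contrapT => z_irrat.
(* Avoiding [B] makes [S] the graph of the identity of a subfield [L] that does
   not contain [z]. *)
pose B : set (F * F) := [set u | u.1 != u.2 \/ u = (z, z)].
have [|S [Siso ratS SB Smax]] := @subfield_iso_Zorn _ _ B (ratr_subfield_iso F).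
  rewrite -subset0 => _ [[q _ <-]] [|[zq _]] /=; first by rewrite eqxx.
  by apply: z_irrat; exists q.
have Sdiag u : S u -> u.1 = u.2.
  move=> Su; apply: contrapT => /eqP u12.
  by have : set0 u by rewrite -SB; split=> //; left.
have Sz : ~ S (z, z).
  by move=> Sz; have : set0 (z, z) by rewrite -SB; split=> //; right.
pose dom := @iso_dom _ _ Siso; pose cod := @iso_cod _ _ Siso.
have domcod : dom =1 cod := iso_dom_cod Sdiag.
(* By maximality of [S], the larger graph [simple_ext Siso t] meets [B]; being diagonal, it does so
   at [(z, z)]. *)
have zE t : ~ S (t, t) -> exists p q : {poly iso_field Siso},
    (map_poly dom q).[t] != 0 /\
    z = (map_poly dom p).[t] / (map_poly dom q).[t].
  move=> St; apply: contrapT => nz; apply: St.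
  rewrite -(Smax (simple_ext Siso t)); first exact: simple_ext_gen.
  - exact: simple_ext_iso.
  - exact: simple_ext_sub.
  - rewrite -subset0 => u [[uu uE]] [|uz]; first by rewrite uu eqxx.
    by rewrite uz in uE.
(* If [z ^+ 2] is not in [L], then [z] is in [L(z ^+ 2)], a polynomial equation
   for [z] in which the even and the odd part cannot cancel. *)
have z_alg : algebraicOver dom z.
  have [/(iso_fieldP Siso)[k /(congr1 fst) kz]|] :=
    pselect (S (z ^+ 2, z ^+ 2)).
    exists ('X^2 - k%:P).
      by rewrite monic_neq0 // monicXnsubC.
    rewrite rmorphB /= map_polyXn map_polyC /root hornerD hornerN hornerC.
    by rewrite hornerXn subr_eq0; apply/eqP.
  move=> /zE[p [q [q0 pq]]]; exists ((p \Po 'X^2) - 'X * (q \Po 'X^2)).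
    apply: contraNneq q0 => /subr0_eq/comp_poly_sqr_eq0 ->.
    by rewrite rmorph0 horner0.
  rewrite rmorphB /= [map_poly _ ('X * _)]rmorphM /=.
  rewrite !map_comp_poly map_polyXn map_polyX /root.
  rewrite hornerD hornerN hornerM !horner_comp hornerXn hornerX.
  by move/(canLR (divfK q0)): pq => ->; rewrite subrr.
(* A [t] outside [L] satisfies [z = p(t) / q(t)], and [p - z q] is not zero as
   [z] is not in [L]. *)
have alg t : algebraicOver dom t.
  have [St|St] := pselect (S (t, t)).
    have [k /(congr1 fst)/= <-] := iso_fieldP Siso St.
    exact: (algebraic_id (@iso_dom _ _ Siso)).
  have [p [q [q0 pq]]] := zE t St.
  apply/integral_algebraic.
  pose P := map_poly dom p - z *: map_poly dom q.
  apply: (@integral_root _ _ _ P).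
  (* If [P] were zero, comparing the coefficients at the degree of [q] would write [z] as a quotient
     in L. *)
  - apply: contra_notN Sz => /eqP P0; pose i := (size q).-1.
    have qi : dom q`_i != 0.
      rewrite fmorph_eq0 -lead_coefE lead_coef_eq0.
      by apply: contraNneq q0 => ->; rewrite rmorph0 horner0.
    suff -> : z = dom (p`_i / q`_i).
      by have := iso_field_mem (p`_i / q`_i); rewrite -iso_dom_cod.
    have /eqP : P`_i = 0 by rewrite P0 coef0.
    rewrite coefB coefZ !coef_map /= subr_eq0 => /eqP pqi.
    have -> : dom (p`_i / q`_i) = dom p`_i / dom q`_i by exact: fmorph_div.
    by rewrite /dom pqi mulfK.
  - by rewrite /root /P hornerD hornerN hornerZ pq divfK ?subrr.
  (* The coefficients of [P] are algebraic over L because [z] is. *)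
  - apply/integral_poly => i; rewrite coefB coefZ !coef_map.
    apply: integral_sub; first exact: integral_id.
    apply: integral_mul; last exact: integral_id.
    exact/integral_algebraic.
have [p p_irr pz] := algebraic_irreducible z_alg.
(* In degree one [z] would lie in L. In higher degree [z'] is a root of the cofactor of ['X - z%:P],
   and separability keeps it away from [z]. *)
have [z' pz' z'z] : exists2 z', root (map_poly dom p) z' & z' != z.
  have [p_gt1 _] := p_irr; pose pF := map_poly dom p.
  have [r pE] : exists r, pF = r * ('X - z%:P) by exact/factor_theorem.
  have [p_le2|p_gt2] := leqP (size p) 2.
    have p2 : size p = 2 by apply/eqP; rewrite eqn_leq p_le2.
    case: Sz; suff -> : z = dom (- p`_0 / p`_1).
      by have := iso_field_mem (- p`_0 / p`_1); rewrite -iso_dom_cod.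
    have p1 : dom p`_1 != 0.
      have <- : lead_coef p = p`_1 by rewrite lead_coefE p2.
      by rewrite fmorph_eq0 lead_coef_eq0 -size_poly_gt0 p2.
    have /eqP := rootP pz; rewrite horner_coef size_map_poly p2.
    rewrite !big_ord_recl big_ord0 !coef_map /= addr0 mulr1 expr1.
    rewrite addrC addr_eq0 => /eqP pz0.
    have -> : dom (- p`_0 / p`_1) = dom (- p`_0) / dom p`_1.
      exact: fmorph_div.
    have -> : dom (- p`_0) = - dom p`_0 by exact: rmorphN.
    have {}pz0 : dom p`_1 * z = - dom p`_0 by exact: pz0.
    by rewrite -pz0 mulrC mulKf.
  have r0 : r != 0.
    apply: contraTneq p_gt1 => r0; rewrite -(size_map_poly dom) -/pF pE r0.
    by rewrite mul0r size_poly0.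
  have [|z' rz'] := @closed_root F r.
    have : (2 < size pF)%N by rewrite size_map_poly.
    by rewrite pE size_Mmonic ?monicXsubC // size_XsubC addn2.
  exists z'; first by rewrite -/pF pE rootM rz'.
  apply/eqP => z'z; rewrite {}z'z in rz'.
  (* A double root would make [p] divide its derivative, which is smaller and so would be zero. But
     its top coefficient is the leading coefficient of [p] times the degree, nonzero in
     characteristic zero. *)
  have : p %| p^`().
    rewrite (irreducible_dvdp_root _ p_irr pz) -deriv_map -/pF pE derivM.
    rewrite derivXsubC mulr1 rootE hornerD hornerM hornerXsubC subrr.
    by rewrite mulr0 add0r -rootE.
  have p_neq0 : p != 0 by rewrite -size_poly_gt0 ltnW.
  have [p'0 _|p'0 /dvdp_leq] := eqVneq p^`() 0; last first.
    by move/(_ p'0); rewrite leqNgt lt_size_deriv.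
  have := coef_deriv p (size p).-2.
  rewrite p'0 coef0 prednK; last by case: (size p) p_gt1 => [|[]].
  move/(congr1 dom); rewrite [dom 0]rmorph0 [RHS]rmorphMn /= => /esym/eqP.
  rewrite mulrn_eq0 fmorph_eq0 -lead_coefE lead_coef_eq0 (negPf p_neq0) orbF.
  by case: (size p) p_gt1 => [|[]].
have pz'c : root (map_poly cod p) z'.
  by rewrite -(eq_map_poly domcod).
(* The identity of L extends to an isomorphism sending [z] to [z'], and then to an automorphism,
   which moves [z]. *)
have [T [Tiso ST Tz]] := subfield_iso_extend p_irr pz pz'c.
have dom_alg x : algebraicOver (@iso_dom _ _ Tiso) x.
  by apply: (algebraic_dom_incl Tiso ST); apply: alg.
have cod_alg y : algebraicOver (@iso_cod _ _ Tiso) y.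
  apply: (algebraic_cod_incl Tiso ST); have [r r0 ry] := alg y.
  by exists r => //; rewrite -(eq_map_poly domcod).
have [s [t [st ts sE]]] := subfield_iso_total dom_alg cod_alg.
have /= := sE _ Tz; rewrite (fix_z s t) // => zz'.
by rewrite -zz' eqxx in z'z.
Qed.

(** * Two-by-two matrices *)

Lemma ord2P (i : 'I_2) : i = 0 \/ i = 1.
Proof.
by case: i => [[|[|//]]] i_lt; [left | right]; apply: val_inj.
Qed.

Lemma col2P (K : nzRingType) (u v : 'cV[K]_2) :
  u 0 0 = v 0 0 -> u 1 0 = v 1 0 -> u = v.
Proof.
by move=> e0 e1; apply/matrixP => r s; rewrite [s]ord1; case: (ord2P r) => ->.
Qed.

Lemma matrix2P (K : nzRingType) (A B : 'M[K]_2) :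
  A 0 0 = B 0 0 -> A 0 1 = B 0 1 -> A 1 0 = B 1 0 -> A 1 1 = B 1 1 -> A = B.
Proof.
move=> e00 e01 e10 e11; apply/matrixP => r s.
by case: (ord2P r) => ->; case: (ord2P s) => ->.
Qed.

Lemma mulmx2E (K : nzRingType) m n (A : 'M[K]_(m, 2)) (B : 'M[K]_(2, n)) r s :
  (A *m B) r s = A r 0 * B 0 s + A r 1 * B 1 s.
Proof.
rewrite mxE !big_ord_recl big_ord0 addr0.
by congr (A r _ * B _ s + A r _ * B _ s); apply: val_inj.
Qed.

Lemma det2E (K : comNzRingType) (A : 'M[K]_2) :
  \det A = A 0 0 * A 1 1 - A 0 1 * A 1 0.
Proof.
rewrite (expand_det_row _ 0) !big_ord_recl big_ord0 addr0 /cofactor !det_mx11.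
rewrite !mxE /= expr0 mul1r expr1 mulN1r mulrN.
by congr (A _ _ * A _ _ - A _ _ * A _ _); apply: val_inj.
Qed.

Lemma tr2E (K : comNzRingType) (A : 'M[K]_2) : \tr A = A 0 0 + A 1 1.
Proof.
rewrite /mxtrace !big_ord_recl big_ord0 addr0.
by congr (A _ _ + A _ _); apply: val_inj.
Qed.

Lemma det_row_mx2 (K : comNzRingType) (u v : 'cV[K]_2) :
  \det (row_mx u v : 'M[K]_2) = u 0 0 * v 1 0 - v 0 0 * u 1 0.
Proof.
rewrite det2E [RHS]/=.
have E0 r : row_mx u v r 0 = u r 0.
  by rewrite -(row_mxEl u v r 0); congr (row_mx u v r _); apply: val_inj.
have E1 r : row_mx u v r 1 = v r 0.
  by rewrite -(row_mxEr u v r 0); congr (row_mx u v r _); apply: val_inj.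
by rewrite !E0 !E1.
Qed.

Section ColoringMatrix.
Variable R : realType.
Local Notation C := R[i].
Implicit Types (a b : 'cV[C]_2) (A : 'M[C]_2).

Lemma coloring_mxE b :
  (coloring_mx b 0 0 = 1 - b 0 0 * b 1 0) *
  (coloring_mx b 0 1 = b 0 0 ^+ 2) *
  (coloring_mx b 1 0 = - b 1 0 ^+ 2) *
  (coloring_mx b 1 1 = 1 + b 0 0 * b 1 0).
Proof. by rewrite !mxE. Qed.

Lemma coloring_mxN b : coloring_mx (- b) = coloring_mx b.
Proof. by apply: matrix2P; rewrite !coloring_mxE !mxE; ring. Qed.

Lemma coloring_mx_sign (e : bool) b :
  coloring_mx ((-1) ^+ e *: b) = coloring_mx b.
Proof. by case: e; rewrite ?expr0 ?expr1 ?scale1r ?scaleN1r ?coloring_mxN. Qed.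

Lemma coloring_mx_fix b : coloring_mx b *m b = b.
Proof. by apply: col2P; rewrite mulmx2E !coloring_mxE; ring. Qed.

(** [coloring_mx b] is the transvection sending [w] to [w + det(b, w) b], and [A] preserves the
    determinant form. *)
Lemma coloring_mx_equivariant A b : \det A = 1 ->
  coloring_mx (A *m b) *m A = A *m coloring_mx b.
Proof.
(* The equation is solved for a monomial, the form in which [ring] can use it for rewriting. *)
rewrite det2E => A1; have {A1} A1 : A 0 0 * A 1 1 = 1 + A 0 1 * A 1 0.
  by rewrite -A1 subrK.
by apply: matrix2P; rewrite !mulmx2E !coloring_mxE !mulmx2E; ring: A1.
Qed.

(** The squares of the coordinates agree, and the product of the coordinates fixes the relative
    sign; opposite signs force a coordinate to vanish, and its sign is then free. *)
Lemma coloring_mx_inj a b :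
  coloring_mx a = coloring_mx b -> a = b \/ a = - b.
Proof.
move=> ab; have := coloring_mxE a; rewrite ab !coloring_mxE.
move=> [[[_ /esym/eqP e00] /oppr_inj/esym/eqP e11] /addrI e01].
rewrite eqf_sqr in e00; rewrite eqf_sqr in e11.
have opp_eq0 (u : C) : u = - u -> u = 0.
  move=> uN; have /eqP : u *+ 2 = 0 by rewrite mulr2n {1}uN addNr.
  by rewrite mulrn_eq0 => /eqP.
have b01 : b 0 0 * b 1 0 = - (b 0 0 * b 1 0) -> b 0 0 = 0 \/ b 1 0 = 0.
  by move=> /opp_eq0/eqP; rewrite mulf_eq0 => /orP[]/eqP; [left | right].
case/orP: e00 e11 => /eqP e0 /orP[]/eqP e1.
- by left; apply: col2P.
- move: e01; rewrite e0 e1 mulrN => /b01[b0|b1].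
    by right; apply: col2P; rewrite !mxE // e0 b0 oppr0.
  by left; apply: col2P; rewrite // e1 b1 oppr0.
- move: e01; rewrite e0 e1 mulNr => /b01[b0|b1].
    by left; apply: col2P; rewrite // e0 b0 oppr0.
  by right; apply: col2P; rewrite !mxE // e1 b1 oppr0.
- by right; apply: col2P; rewrite !mxE.
Qed.

(** With diagonal [1 - p, 1 + p] and upper entry [q], the determinant gives [p ^+ 2 = - A 1 0 * q].
    So [x = sqrtC q], [y = p / x] works, unless [q = 0]; then [p = 0], and one takes [x = 0] with
    [y] a root of [- A 1 0]. *)
Lemma coloring_mx_surj A : \tr A = 2 -> \det A = 1 ->
  exists b, A = coloring_mx b.
Proof.
rewrite tr2E det2E => trA detA.
have [p A11] : exists p, A 1 1 = 1 + p by exists (A 1 1 - 1); ring.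
have A00 : A 0 0 = 1 - p by rewrite -(addrK (A 1 1) (A 0 0)) trA A11; ring.
have [q A01] : exists q, A 0 1 = q by exists (A 0 1).
move: detA; rewrite A00 A11 A01 => detA.
have pq : p ^+ 2 = - A 1 0 * q.
  transitivity (1 - ((1 - p) * (1 + p) - q * A 1 0) - A 1 0 * q); first by ring.
  by rewrite detA; ring.
have mk x y : x ^+ 2 = q -> y ^+ 2 = - A 1 0 -> x * y = p ->
    exists b, A = coloring_mx b.
  move=> xq y2 xy; exists (\col_i if i == 0 then x else y).
  by apply: matrix2P;
    rewrite !coloring_mxE !mxE /= ?A00 ?A01 ?A11 ?xy ?xq ?y2 ?opprK.
have [q0|q0] := eqVneq q 0.
  apply: (mk 0 (sqrtC (- A 1 0))); rewrite ?sqrtCK ?q0 ?expr0n ?mul0r //.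
  by apply/esym/eqP; rewrite -sqrf_eq0 pq q0 mulr0.
have sq : sqrtC q != 0 by rewrite sqrtC_eq0.
apply: (mk (sqrtC q) (p / sqrtC q)); rewrite ?sqrtCK //.
  by rewrite expr_div_n sqrtCK pq mulfK.
by rewrite mulrC divfK.
Qed.

Lemma tr_coloring_mxM a b :
  \tr (coloring_mx a *m coloring_mx b)
  = 2 - \det (row_mx a b : 'M[C]_2) ^+ 2.
Proof. by rewrite tr2E !mulmx2E !coloring_mxE det_row_mx2; ring. Qed.

Lemma det_row_mxM A a b :
  \det (row_mx (A *m a) (A *m b) : 'M[C]_2)
  = \det A * \det (row_mx a b : 'M[C]_2).
Proof. by rewrite -mul_mx_row; apply: (det_mulmx A (row_mx a b)). Qed.

Lemma det_row_mxZ (d : C) a b :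
  \det (row_mx (d *: a) (d *: b) : 'M[C]_2)
  = d ^+ 2 * \det (row_mx a b : 'M[C]_2).
Proof. by rewrite !det_row_mx2 !mxE; ring. Qed.

Lemma sign_eigenvalue_tr A b (d : C) : \det A = 1 -> d ^+ 2 = 1 -> b != 0 ->
  A *m b = d *: b -> \tr A = 2 * d.
Proof.
rewrite det2E tr2E => detA d2 b0 /matrixP Ab.
have := Ab 0 0; have := Ab 1 0; rewrite !mulmx2E !mxE => e1 e0 {Ab}.
set t := A 0 0 + A 1 1.
(* As [\det A = d ^+ 2 = 1], the scalar is [det(A - d)]. The identities below multiply
   [(A - d) b = 0] by the adjugate of [A - d]. *)
have tb : (2 - t * d) *: b = 0.
  move: e0 e1 => /eqP + /eqP; rewrite -subr_eq0 => /eqP e0.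
  rewrite -subr_eq0 => /eqP e1.
  apply: col2P; rewrite !mxE.
    transitivity ((A 1 1 - d) * (A 0 0 * b 0 0 + A 0 1 * b 1 0 - d * b 0 0)
      - A 0 1 * (A 1 0 * b 0 0 + A 1 1 * b 1 0 - d * b 1 0)
      - (A 0 0 * A 1 1 - A 0 1 * A 1 0 - 1) * b 0 0 - (d ^+ 2 - 1) * b 0 0).
      by rewrite /t; ring.
    by rewrite e0 e1 detA d2 !subrr; ring.
  transitivity ((A 0 0 - d) * (A 1 0 * b 0 0 + A 1 1 * b 1 0 - d * b 1 0)
    - A 1 0 * (A 0 0 * b 0 0 + A 0 1 * b 1 0 - d * b 0 0)
    - (A 0 0 * A 1 1 - A 0 1 * A 1 0 - 1) * b 1 0 - (d ^+ 2 - 1) * b 1 0).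
    by rewrite /t; ring.
  by rewrite e0 e1 detA d2 !subrr; ring.
have /eqP td : t * d == 2.
  by move/eqP: tb; rewrite scaler_eq0 (negPf b0) orbF subr_eq0 eq_sym.
by rewrite -td -mulrA -expr2 d2 mulr1.
Qed.

End ColoringMatrix.

(** * Walking along the knot *)

Section KnotWalk.
Variables (N : nat) (D : knot_diagram N).
Local Notation nx := (Defs.next D).
Implicit Types (c n : 'I_N) (s : pass N) (k : nat).

Definition over_letter n : knot_group D :=
  if positive D n then wirtinger D (arc_over D n)
  else ((wirtinger D (arc_over D n))^-1)%g.

Lemma wirtinger_arc_out n :
  wirtinger D (arc_out D n) = (wirtinger D (arc_in D n) ^ over_letter n)%g.
Proof.
pose cls := presented_class (range (wirtinger_rel D)).
have clsM (v w : word 'I_N) : cls (v ++ w) = (cls v * cls w)%g :> knot_group D.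
  by rewrite [RHS]presented_mulE.
have clsV (l : 'I_N) :
    cls [:: (l, false)] = ((cls [:: (l, true)])^-1)%g :> knot_group D.
  have TF : (cls [:: (l, true)] * cls [:: (l, false)])%g = 1%g :> knot_group D.
    rewrite [LHS]presented_mulE; apply/presentedP.
    exact: (WordCancel _ l true).
  by rewrite -[LHS](mulKg (cls [:: (l, true)] : knot_group D)) TF mulg1.
have rel : cls (wirtinger_rel D n).1 = cls (wirtinger_rel D n).2.
  by apply/presentedP; apply: WordRel; exists n.
rewrite /over_letter conjgE -[LHS]/(cls (wirtinger_rel D n).1) rel /=.
case: ifP => _.
  rewrite -[[:: _; _; _]]/([:: _] ++ ([:: _] ++ [:: _])).
  by rewrite !clsM clsV.
rewrite invgK -[[:: _; _; _]]/([:: _] ++ ([:: _] ++ [:: _])).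
by rewrite !clsM clsV.
Qed.

Lemma card_pass : #|{: pass N}| = N.*2.
Proof. by rewrite card_prod card_ord card_bool muln2. Qed.

Lemma card_porbit_next s : #|porbit nx s| = N.*2.
Proof.
by rewrite -card_pass; apply: eq_card => t; rewrite (next_cyclic D s t).
Qed.

Lemma iter_next_period s : iter N.*2 nx s = s.
Proof. by rewrite -(card_porbit_next s) iter_porbit. Qed.

Lemma uniq_traject_next s : uniq (traject nx s N.*2).
Proof. by rewrite -(card_porbit_next s) uniq_traject_porbit. Qed.

Lemma mem_traject_next s t : t \in traject nx s N.*2.
Proof. by rewrite -(card_porbit_next s) -porbit_traject (next_cyclic D). Qed.

Definition pass_index s t := index t (traject nx s N.*2).

Lemma pass_index_lt s t : (pass_index s t < N.*2)%N.
Proof. by rewrite -(size_traject nx s N.*2) index_mem mem_traject_next. Qed.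

Lemma iter_pass_index s t : iter (pass_index s t) nx s = t.
Proof.
by rewrite -(nth_traject nx (pass_index_lt s t)) nth_index ?mem_traject_next.
Qed.

Lemma pass_index_iter s k : (k < N.*2)%N -> pass_index s (iter k nx s) = k.
Proof.
move=> k_lt; rewrite -(nth_traject nx k_lt).
by rewrite /pass_index index_uniq ?size_traject ?uniq_traject_next.
Qed.

Lemma arc_out_surj i : exists c, i = arc_out D c.
Proof.
have [f _ fK] := injF_bij (@diag_arc_under _ D).
by exists (f i); rewrite /arc_out fK.
Qed.

(** The arc changes only at under-passes, so a property of the arcs met along the knot is carried
    over over-passes and has to be transported across crossings only. *)
Lemma walk_ind s (P : nat -> 'I_N -> Prop) :
    P 0%N (diag_arc D s) ->
    (forall k i, P k i -> (iter k.+1 nx s).2 -> P k.+1 i) ->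
    (forall k c, P k (arc_in D c) -> iter k.+1 nx s = under_pass c ->
      P k.+1 (arc_out D c)) ->
  forall k, P k (diag_arc D (iter k nx s)).
Proof.
move=> P0 Pover Punder; elim=> //= k IHk.
have [over|] := boolP (nx (iter k nx s)).2.
  by rewrite diag_arc_over //; apply: Pover.
case eqs : (nx _) => [c o] /= /negbTE o0; rewrite o0 in eqs *.
apply: Punder => //.
by rewrite /arc_in -[under_pass c]eqs permK.
Qed.

Section Walk.
Variable s : pass N.

(** A partial longitude: for [s = under_pass c] and [k = N.*2] it is the first factor of
    [longitude_at c]. *)
Definition walk k : knot_group D :=
  (\prod_(t <- traject nx (nx s) k | ~~ t.2) over_letter t.1)%g.

Lemma walkS k : walk k.+1 =
  (walk k * (if ~~ (iter k.+1 nx s).2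
             then over_letter (iter k.+1 nx s).1 else 1))%g.
Proof. by rewrite /walk trajectSr big_rcons -iterSr. Qed.

Lemma wirtinger_walk k :
  wirtinger D (diag_arc D (iter k nx s))
  = (wirtinger D (diag_arc D s) ^ walk k)%g.
Proof.
pose P k i := wirtinger D i = (wirtinger D (diag_arc D s) ^ walk k)%g.
apply: (@walk_ind s P) => [|{}k i Pk over|{}k c Pk eqs]; rewrite /P.
- by rewrite /walk big_nil conjg1.
- by rewrite walkS over mulg1.
- by rewrite walkS eqs /= conjgM -Pk wirtinger_arc_out.
Qed.

Variable (K : comNzRingType) (eps : 'I_N -> bool).

Definition walk_sign k : K :=
  \prod_(t <- traject nx (nx s) k | ~~ t.2) (-1) ^+ eps t.1.

Lemma walk_signS k : walk_sign k.+1 = walk_sign k *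
  (if ~~ (iter k.+1 nx s).2 then (-1) ^+ eps (iter k.+1 nx s).1 else 1).
Proof. by rewrite /walk_sign trajectSr big_rcons -iterSr. Qed.

(** One full turn goes through each under-pass exactly once. *)
Lemma walk_sign_period : walk_sign N.*2 = \prod_n (-1) ^+ eps n.
Proof.
rewrite /walk_sign (perm_big (index_enum (pass N))) /=; last first.
  apply: uniq_perm; rewrite ?uniq_traject_next ?index_enum_uniq //.
  by move=> t; rewrite mem_traject_next mem_index_enum.
rewrite (eq_bigl (fun t : pass N => xpredT t.1 && ~~ t.2)) //.
rewrite -(pair_big xpredT negb (fun n _ => (-1) ^+ eps n)) /=.
by apply: eq_bigr => n _; rewrite big_mkcond big_bool /= mul1r.
Qed.

Lemma walk_sign_bool k : exists e : bool, walk_sign k = (-1) ^+ e.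
Proof.
rewrite /walk_sign; elim/big_ind: _ => [|_ _ [d ->] [e ->]|t _].
- by exists false.
- by exists (d (+) e); rewrite signr_addb.
- by exists (eps t.1).
Qed.

End Walk.
End KnotWalk.

(** * Existence and uniqueness of arc-colorings *)

Section SL2Facts.
Variable R : realType.

Lemma SL2_valM (A B : SL2 R) : val (A * B)%g = val A *m val B.
Proof. by []. Qed.

Lemma SL2_mulK (A : SL2 R) m (B : 'M[R[i]]_(2, m)) :
  val (A^-1)%g *m (val A *m B) = B.
Proof. by rewrite mulmxA mulVmx ?mul1mx // SL2_unit. Qed.

Lemma SL2_trJ (A B : SL2 R) : \tr (val (A ^ B)%g) = \tr (val A).
Proof.
rewrite conjgE !SL2_valM mxtrace_mulC -mulmxA mulmxV ?mulmx1 //.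
exact: SL2_unit.
Qed.

Lemma coloring_mx_SL2 (A : SL2 R) b :
  coloring_mx (val A *m b) = val A *m coloring_mx b *m val (A^-1)%g.
Proof.
rewrite -coloring_mx_equivariant ?SL2_det //.
by rewrite -mulmxA mulmxV ?mulmx1 // SL2_unit.
Qed.

End SL2Facts.

Section Colorings.
Variables (R : realType) (N : nat) (D : knot_diagram N).
Local Notation C := R[i].
Local Notation nx := (Defs.next D).
Implicit Types (rho : parabolic R D) (eps : 'I_N -> bool).
Implicit Types (a : 'I_N -> 'cV[C]_2).

Lemma rep1 rho : rho 1%g = 1%g.
Proof. by apply: (mulgI (rho 1%g)); rewrite -gmulfM !mulg1. Qed.

Lemma repV rho x : rho (x^-1)%g = ((rho x)^-1)%g.
Proof. by apply: (mulgI (rho x)); rewrite -gmulfM !mulgV rep1. Qed.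

Lemma repJ rho x y : rho (x ^ y)%g = (rho x ^ rho y)%g.
Proof. by rewrite !conjgE !gmulfM repV. Qed.

Lemma rep_prod rho I (r : seq I) (P : pred I) (E : I -> knot_group D) :
  rho (\prod_(i <- r | P i) E i)%g = (\prod_(i <- r | P i) rho (E i))%g.
Proof. by apply: big_morph; [exact: gmulfM | exact: rep1]. Qed.

Lemma parabolic_coloring_mx rho i :
  exists b, b != 0 /\ val (rho (wirtinger D i)) = coloring_mx b.
Proof.
have [_ rhoP] := parabolic_repP rho.
have [|tr2 neq1] := rhoP (wirtinger D i).
  by exists i, 1%g; rewrite conjg1.
have [b bE] := coloring_mx_surj tr2 (SL2_det _).
exists b; split=> //; apply/eqP => b0; apply: neq1; apply: val_inj.
rewrite /= bE b0; apply: matrix2P; rewrite !coloring_mxE !mxE /=; ring.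
Qed.

(** For both signs of the crossing, the color of the incoming arc is transported by the inverse of
    [rho] of the letter, the same letter that conjugates the meridians. *)
Lemma arc_coloringP eps rho a : associated_rep a rho ->
  arc_coloring D eps a <->
  forall n, (-1) ^+ eps n *: a (arc_out D n)
    = val (rho (over_letter D n))^-1%g *m a (arc_in D n).
Proof.
move=> aP.
have letterE n : val (rho (over_letter D n))^-1%g =
    if positive D n then invmx (coloring_mx (a (arc_over D n)))
    else coloring_mx (a (arc_over D n)).
  by rewrite -aP /over_letter; case: ifP => // _; rewrite repV invgK.
by split=> aE n; move: (aE n); rewrite letterE; case: ifP.
Qed.

(** The last factor of the longitude is a power of a meridian whose image fixes [b], so the
    longitude acts on [b] as the full walk does. *)
Lemma longitude_at_tr rho c b (d : C) : d ^+ 2 = 1 -> b != 0 ->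
    val (rho (wirtinger D (arc_out D c))) = coloring_mx b ->
    val (rho (walk D (under_pass c) N.*2)) *m b = d *: b ->
  \tr (val (rho (longitude_at D c))) = 2 * d.
Proof.
move=> d2 b0 rhoE walkE.
apply: (@sign_eigenvalue_tr _ _ b) => //; first exact: SL2_det.
rewrite /longitude_at gmulfM SL2_valM -mulmxA -walkE; congr (_ *m _).
have fix_rho : val (rho (wirtinger D (arc_out D c))) *m b = b.
  by rewrite rhoE coloring_mx_fix.
rewrite rep_prod; elim/big_ind: _ => [|A B Ab Bb|n _].
- by rewrite mul1mx.
- by rewrite SL2_valM -mulmxA Bb Ab.
- by case: ifP => _ //; rewrite repV -[in LHS]fix_rho SL2_mulK.
Qed.

Lemma coloring_exists (lambda : knot_group D) rho (epsp epsm : 'I_N -> bool) :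
    longitude lambda ->
    \prod_(n < N) (-1) ^+ epsp n = 1 :> int ->
    \prod_(n < N) (-1) ^+ epsm n = -1 :> int ->
  let eps := if obstruction lambda rho == 1 then epsp else epsm in
  exists a, arc_coloring D eps a /\ associated_rep a rho.
Proof.
move=> [c [g ->]] epspE epsmE eps.
pose s := under_pass c.
have [b [b0 bE]] := parabolic_coloring_mx rho (arc_out D c).
(* [v k] is to be the color of the arc reached after [k] passes: [b] transported along the walk,
   with the signs of the under-passes met. *)
pose B k := val (rho (walk D s k))^-1%g.
pose v k := walk_sign D s C eps k *: (B k *m b).
have vE k :
    coloring_mx (v k) = val (rho (wirtinger D (diag_arc D (iter k nx s)))).
  rewrite /v; have [e ->] := walk_sign_bool D s C eps k.
  rewrite coloring_mx_sign coloring_mx_SL2 invgK -bE wirtinger_walk.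
  by rewrite repJ conjgE !SL2_valM mulmxA.
(* After one turn the walk is back on the first arc, so the transported vector has the coloring
   matrix of [b]. *)
have [d Bb] : exists d : bool, B N.*2 *m b = (-1) ^+ d *: b.
  have : coloring_mx (B N.*2 *m b) = coloring_mx b.
    rewrite -bE -[arc_out D c]/(diag_arc D s) -[in RHS](iter_next_period D s).
    rewrite -vE /v; have [e ->] := walk_sign_bool D s C eps N.*2.
    by rewrite coloring_mx_sign.
  case/coloring_mx_inj => ->; [exists false | exists true].
    by rewrite scale1r.
  by rewrite scaleN1r.
have obE : obstruction (longitude_at D c ^ g)%g rho = (-1) ^+ d.
  rewrite /obstruction repJ SL2_trJ.
  rewrite (@longitude_at_tr rho c b ((-1) ^+ d)) ?sqrr_sign //.
    by rewrite mulKf // pnatr_eq0.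
  (* [Bb] concerns the inverse of the walk; a sign is its own inverse. *)
  have := mulKVmx (SL2_unit (rho (walk D s N.*2))) b.
  by rewrite [X in _ *m X]Bb -scalemxAr => e; rewrite -[in RHS]e signrZK.
(* Here the choice of [eps] enters: the product of its signs is the obstruction class, which [obE]
   identifies with the sign of the turn. *)
have signE : walk_sign D s C eps N.*2 = (-1) ^+ d.
  have prodE (eps' : 'I_N -> bool) z :
      \prod_(n < N) (-1) ^+ eps' n = z :> int ->
      \prod_(n < N) (-1) ^+ eps' n = z%:~R :> C.
    move=> <-; rewrite rmorph_prod; apply: eq_bigr => n _.
    by rewrite rmorph_sign.
  rewrite walk_sign_period /eps obE; case: (d) => /=.
    rewrite expr1 eq_sym -subr_eq0 opprK -mulr2n pnatr_eq0 /=.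
    by rewrite (prodE _ _ epsmE).
  by rewrite expr0 eqxx (prodE _ _ epspE).
have v_per : v N.*2 = v 0%N.
  rewrite /v signE Bb /walk_sign big_nil scale1r /B /walk big_nil rep1 invg1.
  by rewrite mul1mx scalerA -signr_addb addbb scale1r.
have vS_over k : (iter k.+1 nx s).2 -> v k.+1 = v k.
  by move=> over; rewrite /v /B walkS walk_signS over mulr1 mulg1.
have vS_under k n : iter k.+1 nx s = under_pass n ->
    v k.+1 = (-1) ^+ eps n *: (val (rho (over_letter D n))^-1%g *m v k).
  move=> under; rewrite /v /B.
  have -> : walk D s k.+1 = (walk D s k * over_letter D n)%g.
    by rewrite walkS under.
  have -> : walk_sign D s C eps k.+1 = (-1) ^+ eps n * walk_sign D s C eps k.
    by rewrite walk_signS under mulrC.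
  by rewrite gmulfM invMg SL2_valM -scalemxAr scalerA -mulmxA.
have [f outK _] := injF_bij (@diag_arc_under _ D).
(* The indices [k] range over [1 .. 2N], so that closing up ([v_per]) is only
   needed at the base arc. *)
pose a i := v (pass_index D s (nx^-1%g (under_pass (f i)))).+1.
have av k : (k <= N.*2)%N -> a (diag_arc D (iter k nx s)) = v k.
  pose P k i := (k <= N.*2)%N -> a i = v k.
  apply: (@walk_ind _ D s P) => [|{}k i Pk over|{}k n Pk under] k_le.
  - have N_gt0 : (0 < N.*2)%N by apply: leq_trans (pass_index_lt D s s).
    rewrite /a outK -v_per -/s; congr v.
    (* The pass before [s] is the last of the turn, so [a] takes the value [v N.*2] at the base
       arc. *)
    have -> : nx^-1%g s = iter (N.*2).-1 nx s.
      by rewrite -{1}(iter_next_period D s) -(prednK N_gt0) iterS permK.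
    by rewrite pass_index_iter prednK.
  - by rewrite vS_over // Pk // ltnW.
  - by rewrite /a outK -under iterS permK pass_index_iter.
have aP : associated_rep a rho.
  move=> i; have [n ->] := arc_out_surj D i.
  have := av (pass_index D s (under_pass n)) (ltnW (pass_index_lt _ _ _)).
  by rewrite iter_pass_index -/(arc_out D n) => ->; rewrite vE iter_pass_index.
exists a; split=> //; apply/(arc_coloringP _ aP) => n.
pose k := pass_index D s (nx^-1%g (under_pass n)).
have kE : iter k nx s = nx^-1%g (under_pass n) by rewrite iter_pass_index.
have k_lt : (k < N.*2)%N by apply: pass_index_lt.
have SkE : iter k.+1 nx s = under_pass n by rewrite iterS kE permKV.
have := av k.+1 k_lt; rewrite SkE -/(arc_out D n) => ->.
have := av k (ltnW k_lt); rewrite kE -/(arc_in D n) => ->.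
by rewrite (vS_under k n SkE) scalerA -signr_addb addbb scale1r.
Qed.

(** At one arc the representation determines the color up to sign, and transport along the knot
    carries this sign to all arcs. *)
Lemma coloring_unique eps rho a a' :
    arc_coloring D eps a -> associated_rep a rho ->
    arc_coloring D eps a' -> associated_rep a' rho ->
  exists e : bool, forall i, a' i = (-1) ^+ e *: a i.
Proof.
move=> aE aP a'E a'P.
have [c _|N0] := pickP 'I_N; last by exists false => i; have := N0 i.
pose s := under_pass c.
have [e eE] : exists e : bool,
    a' (diag_arc D s) = (-1) ^+ e *: a (diag_arc D s).
  have : coloring_mx (a' (diag_arc D s)) = coloring_mx (a (diag_arc D s)).
    by rewrite -aP -a'P.
  case/coloring_mx_inj => ->; [exists false | exists true].
    by rewrite scale1r.
  by rewrite scaleN1r.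
exists e => i; have [n ->] := arc_out_surj D i.
rewrite /arc_out -(iter_pass_index D s (under_pass n)).
apply: (@walk_ind _ D s (fun _ i => a' i = (-1) ^+ e *: a i)) => // k c' IH _.
have := (arc_coloringP eps a'P).1 a'E c'.
have := (arc_coloringP eps aP).1 aE c'.
rewrite IH -scalemxAr => <- /(congr1 (GRing.scale ((-1) ^+ eps c'))).
rewrite signrZK => ->; rewrite !scalerA; congr (_ *: _).
by case: (e); case: (eps c');
  rewrite ?expr1 ?expr0 ?mulrN1 ?mulN1r ?mulr1 ?opprK.
Qed.

End Colorings.

(** * Galois action on the character variety *)

Section GaloisSL2.
Variables (R : realType) (s : {rmorphism R[i] -> R[i]}).

Lemma SL2_map_subproof (A : SL2 R) : \det (map_mx s (val A)) == 1.
Proof. by rewrite det_map_mx SL2_det rmorph1. Qed.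

Definition SL2_map (A : SL2 R) : SL2 R :=
  Sub (map_mx s (val A)) (SL2_map_subproof A).

Lemma SL2_mapM (A B : SL2 R) : SL2_map (A * B)%g = (SL2_map A * SL2_map B)%g.
Proof. by apply: val_inj; rewrite /= map_mxM. Qed.

HB.instance Definition _ :=
  isMultiplicative.Build (SL2 R) (SL2 R) SL2_map SL2_mapM.

Lemma SL2_map1 : SL2_map 1%g = 1%g.
Proof. by apply: val_inj; rewrite /= map_mx1. Qed.

Lemma SL2_map_inj : injective SL2_map.
Proof.
move=> A B /(congr1 val)/matrixP AB; apply: val_inj; apply/matrixP => i j.
by have := AB i j; rewrite /= !mxE => /fmorph_inj.
Qed.

Lemma SL2_mapV (A : SL2 R) : SL2_map (A^-1)%g = ((SL2_map A)^-1)%g.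
Proof. by apply: (mulgI (SL2_map A)); rewrite -SL2_mapM !mulgV SL2_map1. Qed.

Lemma SL2_mapJ (A B : SL2 R) : SL2_map (A ^ B)%g = (SL2_map A ^ SL2_map B)%g.
Proof. by rewrite !conjgE !SL2_mapM SL2_mapV. Qed.

Lemma SL2_map_tr (A : SL2 R) : \tr (val (SL2_map A)) = s (\tr (val A)).
Proof. by rewrite /= -trace_map_mx. Qed.

Lemma map_coloring_mx b : map_mx s (coloring_mx b) = coloring_mx (map_mx s b).
Proof.
apply: matrix2P; rewrite !coloring_mxE !mxE /=.
- by rewrite rmorphB rmorphM rmorph1.
- by rewrite rmorphXn.
- by rewrite rmorphN rmorphXn.
- by rewrite rmorphD rmorphM rmorph1.
Qed.

End GaloisSL2.

Section GaloisRep.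
Variables (R : realType) (N : nat) (D : knot_diagram N).
Local Notation C := R[i].
Local Notation X := (Xpar R D).
Local Notation Q := {eq_quot (conjugate_rep_equiv R D)}.
Implicit Types (rho : parabolic R D) (s t : {rmorphism C -> C}).

Lemma galois_rep_parabolic s rho :
  is_parabolic (SL2_map s \o rho : {multiplicative knot_group D -> SL2 R}).
Proof.
have [[g [h gh]] rhoP] := parabolic_repP rho; split.
  by exists g, h => /=; rewrite -!SL2_mapM => /SL2_map_inj.
move=> m /rhoP[tr2 neq1]; split; first by rewrite SL2_map_tr tr2 rmorph_nat.
by rewrite /= -(SL2_map1 s) => /SL2_map_inj.
Qed.

Definition galois_rep s rho := Parabolic (galois_rep_parabolic s rho).

(** The chosen representative of the image is only conjugate to the image of the chosen one;
    [galois_conj] provides the conjugating matrix. *)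
Definition galois s (x : X) : X := \pi_Q (galois_rep s (repr x)).

Lemma galois_conj s x : exists P : SL2 R,
  forall g, repr (galois s x) g = (SL2_map s (repr x g) ^ P)%g.
Proof.
have /eqmodP/asboolP[P PE] :
    galois_rep s (repr x) = repr (galois s x) %[mod Q].
  by rewrite reprK.
by exists P.
Qed.

Lemma galois_tr s x g :
  \tr (val (repr (galois s x) g)) = s (\tr (val (repr x g))).
Proof. by have [P ->] := galois_conj s x; rewrite SL2_trJ SL2_map_tr. Qed.

Lemma galoisK s t : cancel s t -> cancel (galois s) (galois t).
Proof.
move=> st x; rewrite -[RHS]reprK; apply/eqmodP; rewrite equiv_sym.
apply/asboolP; have [P PE] := galois_conj s x.
exists (SL2_map t P) => g /=; rewrite PE SL2_mapJ; congr (_ ^ _)%g.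
by apply: val_inj; apply/matrixP => i j; rewrite /= !mxE st.
Qed.

(** Composing a trace function with [galois t] applies [t] to its values, which the outer [s]
    undoes; a constant [c] merely becomes [s c]. *)
Lemma galois_regular s t f : cancel t s -> regular_fun f ->
  regular_fun (fun x : X => s (f (galois t x))).
Proof.
move=> ts; elim=> [c|g|{}f h _ IHf _ IHh|{}f h _ IHf _ IHh].
- exact: RegularCst.
- have -> : (fun x : X => s (\tr (val (repr (galois t x) g)))) =
      (fun x => \tr (val (repr x g))); last exact: RegularTr.
    by apply/funext => x; rewrite galois_tr ts.
- have -> : (fun x : X => s (f (galois t x) + h (galois t x))) =
      (fun x => s (f (galois t x)) + s (h (galois t x)));
    last exact: RegularAdd.
    by apply/funext => x; rewrite rmorphD.
- have -> : (fun x : X => s (f (galois t x) * h (galois t x))) =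
      (fun x => s (f (galois t x)) * s (h (galois t x)));
    last exact: RegularMul.
    by apply/funext => x; rewrite rmorphM.
Qed.

Lemma galois_closed s t Z : cancel t s -> zariski_closed Z ->
  zariski_closed (galois t @^-1` Z).
Proof.
move=> ts [F [Freg ->]].
exists [set (fun x => s (f (galois t x))) | f in F]; split.
  by move=> _ [f /Freg freg <-]; apply: galois_regular.
apply/seteqP; split=> x /= Fx.
  by move=> _ [f Ff <-]; rewrite Fx // rmorph0.
move=> f Ff; apply: (fmorph_inj s).
by rewrite (Fx (fun x => s (f (galois t x)))) ?rmorph0 //; exists f.
Qed.

Lemma galois_irreducible s t Z : cancel s t -> cancel t s ->
  irreducible_closed Z -> irreducible_closed (galois t @^-1` Z).
Proof.
move=> st ts [Zcl [z Zz] Zirr]; split; first exact: (galois_closed ts).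
  by exists (galois s z); rewrite /= (galoisK st).
move=> A B Acl Bcl ZAB.
have pull W : galois t @^-1` Z `<=` W <-> Z `<=` galois s @^-1` W.
  split=> ZW x Zx; first by apply: ZW; rewrite /= (galoisK st).
  by have := ZW _ Zx; rewrite /= (galoisK ts).
have := Zirr _ _ (galois_closed st Acl) (galois_closed st Bcl).
by rewrite -preimage_setU -!pull; apply.
Qed.

(** Components and dimension zero are expressed by inclusions of irreducible closed sets, which
    preimages under the two inverse maps preserve both ways. *)
Lemma galois_Xzero s t : cancel s t -> cancel t s ->
  forall x, Xzero x -> Xzero (galois s x).
Proof.
move=> st ts x [Z [[Zirr Zmax] Zdim Zx]].
have tsZ W : galois t @^-1` (galois s @^-1` W) = W.
  by apply/seteqP; split=> y; rewrite /= (galoisK ts).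
have stZ W : galois s @^-1` (galois t @^-1` W) = W.
  by apply/seteqP; split=> y; rewrite /= (galoisK st).
exists (galois t @^-1` Z); split; last by rewrite /= (galoisK st).
  split; first exact: galois_irreducible st ts Zirr.
  move=> W Wirr ZW; rewrite -[LHS]tsZ; congr (_ @^-1` _).
  apply: Zmax; first exact: galois_irreducible ts st Wirr.
  by rewrite -[Z]stZ; apply: preimage_subset.
move=> W Wirr WZ; rewrite -[LHS]tsZ; congr (_ @^-1` _).
apply: Zdim; first exact: galois_irreducible ts st Wirr.
by rewrite -[Z]stZ; apply: preimage_subset.
Qed.

Lemma galois_Xzero_bij s t : cancel s t -> cancel t s ->
  set_bij (@Xzero R N D) (@Xzero R N D) (galois s).
Proof.
move=> st ts; split=> [x|x y _ _|x Xx].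
- exact: galois_Xzero st ts x.
- exact: can_inj (galoisK st) x y.
- exists (galois t x); last exact: galoisK.
  exact: galois_Xzero ts st x Xx.
Qed.

End GaloisRep.

(** * Polynomials over the isolated points *)

Section RationalPolynomials.
Variable R : realType.
Local Notation C := R[i].

Lemma rational_polyP (p : {poly C}) :
  (forall n, exists q, p`_n = ratr q) -> rational_poly p.
Proof.
move=> /choice[q qE]; exists (\poly_(n < size p) q n).
apply/polyP => n; rewrite coef_map coef_poly /=; case: ltnP => [_|le_pn].
  exact: qE.
by rewrite rmorph0 nth_default.
Qed.

(** No factor equals [1], so the support is all of [A] and the product takes its default value. This
    settles the case of an infinite [Xzero]. *)
Lemma fsbig_XsubC_infinite (T : choiceType) (A : set T) (v : T -> C) :
  ~ finite_set A -> \big[*%R/1]_(x \in A) ('X - (v x)%:P) = 1 :> {poly C}.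
Proof.
move=> Ainf; apply: fsbig_dflt; rewrite (_ : _ `&` _ = A) //.
apply/setIidPl => x _ /= /(congr1 (fun p : {poly C} => size p)).
by rewrite size_XsubC size_poly1.
Qed.

(** The degree is the number of factors, so the sign is distributed as one [-1] to each
    [- 'X - u]. *)
Lemma star_poly_prod (T : Type) (r : seq T) (u : T -> C) :
  star_poly (\prod_(x <- r) ('X - (u x)%:P)) = \prod_(x <- r) ('X + (u x)%:P).
Proof.
rewrite /star_poly size_prod_XsubC /= rmorph_prod /=.
elim: r => [|x r IHr] /=; first by rewrite !big_nil expr0 scale1r.
rewrite !big_cons -IHr exprS -scalerA scalerAr scalerAl; congr (_ * _).
by rewrite comp_polyB comp_polyX comp_polyC scaleN1r opprB opprK addrC.
Qed.

Lemma square_splitting_prod (T : Type) (r : seq T) (u y : T -> C) :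
  (forall x, y x = u x ^+ 2) ->
  (\prod_(x <- r) ('X - (y x)%:P)) \Po 'X^2
  = \prod_(x <- r) ('X - (u x)%:P) * star_poly (\prod_(x <- r) ('X - (u x)%:P)).
Proof.
move=> yE; rewrite star_poly_prod -big_split /= rmorph_prod /=.
apply: eq_bigr => x _; rewrite comp_polyB comp_polyX comp_polyC yE.
by rewrite -subr_sqr rmorphXn.
Qed.

Lemma star_poly1 : star_poly (1 : {poly C}) = 1.
Proof. by rewrite /star_poly size_poly1 expr0 scale1r comp_polyC. Qed.

Variables (N : nat) (D : knot_diagram N).

Lemma galois_equivariant_rational (v : Xpar R D -> C) :
    (forall s t : {rmorphism C -> C}, cancel s t -> cancel t s ->
      forall x, v (galois s x) = s (v x)) ->
  rational_poly (\big[*%R/1]_(x \in @Xzero R N D) ('X - (v x)%:P)).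
Proof.
move=> vE; have [fin|inf] := pselect (finite_set (@Xzero R N D)); last first.
  rewrite fsbig_XsubC_infinite //; exists 1; by rewrite rmorph1.
apply: rational_polyP => n; apply: rat_of_fixed => s t st ts.
set p := \big[_/_]_(_ \in _) _.
suff sp : map_poly s p = p by rewrite -[in RHS]sp coef_map.
(* As [galois s] permutes [Xzero], the right-hand product may be taken over the images, whose roots
   [s (v x)] are those of [map_poly s p]. *)
rewrite /p {2}(reindex_fsbig _ _ _ _ (galois_Xzero_bij D st ts)).
rewrite !fsbig_finite // rmorph_prod; apply: eq_bigr => x _.
by rewrite /= rmorphB /= map_polyX map_polyC (vE s t st ts).
Qed.

Lemma y_value_galois i j (s : {rmorphism C -> C}) (x : Xpar R D) :
  y_value i j (repr (galois s x)) = s (y_value i j (repr x)).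
Proof. by rewrite /y_value galois_tr rmorphB rmorph_nat. Qed.

Variables (lambda : knot_group D) (lambdaP : longitude lambda).
Variables (epsp epsm : 'I_N -> bool).
Hypothesis epspE : \prod_(n < N) (-1) ^+ epsp n = 1 :> int.
Hypothesis epsmE : \prod_(n < N) (-1) ^+ epsm n = -1 :> int.

(** Existence of a coloring rules out the default value of [xget]. *)
Lemma coloring_ofP (rho : parabolic R D)
    (a := coloring_of lambda epsp epsm rho) :
  arc_coloring D (if obstruction lambda rho == 1 then epsp else epsm) a
  /\ associated_rep a rho.
Proof.
pose A := [set b | arc_coloring D
    (if obstruction lambda rho == 1 then epsp else epsm) b
  /\ associated_rep b rho].
suff : A (xget (fun=> 0) A) by [].
by apply: xgetPex; apply: coloring_exists.
Qed.

Lemma u_value_sqr i j (rho : parabolic R D) :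
  y_value i j rho = u_value lambda epsp epsm i j rho ^+ 2.
Proof.
have [_ aP] := coloring_ofP rho.
rewrite /y_value /u_value gmulfM SL2_valM !aP tr_coloring_mxM.
by rewrite opprB addrC subrK.
Qed.

(** Applying [s] to the coloring of [x] and changing basis by [P] gives a coloring for the conjugate
    representation. It agrees with the chosen one up to a global sign, and neither the sign nor [P]
    affects the determinant. *)
Lemma u_value_galois i j (s : {rmorphism C -> C}) (x : Xpar R D) :
  u_value lambda epsp epsm i j (repr (galois s x))
  = s (u_value lambda epsp epsm i j (repr x)).
Proof.
have [aE aP] := coloring_ofP (repr x).
have [bE bP] := coloring_ofP (repr (galois s x)).
rewrite /u_value; move: (coloring_of _ _ _ (repr x)) aE aP => a aE aP.
move: (coloring_of _ _ _ (repr (galois s x))) bE bP => b bE bP.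
(* [s] fixes [1], so both representations use the same sign-type. *)
have obE : (obstruction lambda (repr (galois s x)) == 1)
         = (obstruction lambda (repr x) == 1).
  rewrite /obstruction galois_tr -[RHS](fmorph_eq1 s) rmorphM.
  by rewrite fmorphV rmorph_nat.
rewrite obE in bE.
have [P PE] := galois_conj s x.
pose a' i := val (P^-1)%g *m map_mx s (a i).
have a'P : associated_rep a' (repr (galois s x)).
  move=> k; rewrite /a' PE conjgE !SL2_valM coloring_mx_SL2 invgK.
  by rewrite -map_coloring_mx -aP mulmxA.
have a'E : arc_coloring D
    (if obstruction lambda (repr x) == 1 then epsp else epsm) a'.
  apply/(arc_coloringP _ a'P) => n; move/(arc_coloringP _ aP)/(_ n): aE.
  move=> /(congr1 (map_mx s)); rewrite map_mxM map_mxZ rmorph_sign => aE.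
  rewrite /a' scalemxAr aE PE -conjVg -SL2_mapV conjgE !SL2_valM -!mulmxA.
  by rewrite (mulKVmx (SL2_unit P)).
have [e eE] := coloring_unique a'E a'P bE bP.
rewrite !eE det_row_mxZ sqrr_sign mul1r det_row_mxM SL2_det mul1r.
by rewrite !det_row_mx2 !mxE rmorphB !rmorphM.
Qed.

End RationalPolynomials.

Theorem theorem4p17 (R : realType) (N : nat) (D : knot_diagram N)
    (lambda : knot_group D) (hlambda : longitude lambda)
    (epsp epsm : 'I_N -> bool)
    (hepsp : \prod_(n < N) (-1) ^+ epsp n = 1 :> int)
    (hepsm : \prod_(n < N) (-1) ^+ epsm n = -1 :> int)
    (i j : 'I_N) :
  let Rij : {poly R[i]} := riley_poly R D i j in
  let gij : {poly R[i]} := u_poly R lambda epsp epsm i j in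
  [/\ rational_poly Rij,
      rational_poly gij &
      Rij \Po 'X^2 = gij * star_poly gij].
Proof.
move=> Rij gij; rewrite /Rij /gij /riley_poly /u_poly; split.
- by apply: galois_equivariant_rational => s t _ _ x; apply: y_value_galois.
- by apply: galois_equivariant_rational => s t _ _ x; apply: u_value_galois.
have [fin|inf] := pselect (finite_set (@Xzero R N D)); last first.
  by rewrite !fsbig_XsubC_infinite // star_poly1 mulr1 comp_polyC.
rewrite !fsbig_finite //; apply: square_splitting_prod => x.
exact: u_value_sqr.
Qed.
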